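(* Let $(\mathscr T_t)_{t\ge 0}$ be an $(X,W)$-Crump-Mode-Jagers branching process satisfying the standing assumptions and Assumption A below. Then, almost surely, the infinite tree $\mathcal T_\infty$ contains a node of infinite degree (an infinite star), i.e. there is $u\in\mathcal T_\infty$ such that $ui\in\mathcal T_\infty$ for infinitely many (indeed all) $i\in\mathbb N$. Assumption A: (1) There exist positive random variables $(Y_n)_{n\in\mathbb N_0}$ with finite mean such that for every $w\in S$ and every $n$, $\sum_{i=n+1}^\infty X_w(i)$ is stochastically dominated by $Y_n$. (2) There exists an increasing sequence $(\lambda_n)_{n\in\mathbb N}\subset(0,\infty)$ with $\lambda_n\to\infty$ such that $$\sum_{n=1}^\infty \mathcal M_{\lambda_n}(Y_n)\,\mathbb E\big[\mathcal L_{\lambda_n}(\mathcal P_n(\varnothing);W)\big]<\infty.$$ (3) $\mathbb E[\sup\{k: X(k)=0\}]<1$, and for each $n\in\mathbb N$, almost surely $\sum_{i=n+1}^\infty X(i)>0$.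
   Context: Ulam–Harris tree: $\mathcal U_\infty=\bigcup_{n\ge0}\mathbb N^n$ with $\mathbb N^0=\{\varnothing\}$ (the root); $u=u_1\cdots u_k$ has length $|u|=k$, $ui$ is the $i$-th child of $u$, and $u_{|\ell}=u_1\cdots u_\ell$ for $\ell\le|u|$ are its ancestors. On a probability space, random maps $X:\mathcal U_\infty\to[0,\infty]$ and $W:\mathcal U_\infty\to S$ ($S$ a measurable space) are given; $W_u$ is the weight of $u$ and $X(uj)$ is the waiting time between the births of the $(j-1)$-th and $j$-th child of $u$. Birth times: $\mathcal B(\varnothing)=0$, $\mathcal B(ui)=\mathcal B(u)+\sum_{j=1}^i X(uj)$. Set $\mathcal P_i(u)=\sum_{j=1}^iX(uj)$, $\mathcal P(u)=\sum_{j=1}^\infty X(uj)$; $\mathcal P_i,\mathcal P$ denote copies of $\mathcal P_i(\varnothing),\mathcal P(\varnothing)$, and $X(i)=X(\varnothing i)$, $W=W_\varnothing$. Standing assumptions: the pairs $((X(uj))_{j\in\mathbb N},W_u)$ are i.i.d. over $u\in\mathcal U_\infty$; writing $(X_w(uj))_{j}$ for $(X(uj))_j$ conditioned on $W_u=w$, the variables $(X_w(ui))_{i\in\mathbb N}$ are mutually independent for each $w\in S$. Let $\mathscr T_t=\{x\in\mathcal U_\infty:\mathcal B(x)\le t\}$, $\tau_k=\inf\{t\ge0:|\mathscr T_t|\ge k\}$, $\mathcal T_k$ the tree of the first $k$ individuals of $\mathscr T_{\tau_k}$ ordered by birth time (ties broken lexicographically), and $\mathcal T_\infty=\bigcup_k\mathcal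 T_k$. Notation: $\mathcal M_\lambda(Y)=\mathbb E[e^{\lambda Y}]$ and $\mathcal L_\lambda(Z;W)=\mathbb E[e^{-\lambda Z}\mid W]$. *)

(* Defs.v *)
From mathcomp Require Import all_boot all_algebra.
From mathcomp Require Import all_classical all_reals all_analysis measurable_realfun.
Import GRing.Theory Num.Theory.

Set Implicit Arguments.
Unset Strict Implicit.
Unset Printing Implicit Defensive.

Local Open Scope classical_set_scope.
Local Open Scope ring_scope.
Local Open Scope ereal_scope.

(* Ulam-Harris tree.  A node is a [seq nat]; the root is [::].
   CONVENTION: children are indexed from 0, i.e. [rcons u i] is the
   (i+1)-th child of [u] (the paper's u(i+1)).  So the paper's X(uj),
   j >= 1, is [X (rcons u j.-1)]. *)

Fixpoint lex_lt (u v : seq nat) : bool :=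
  match u, v with
  | [::], [::] => false
  | [::], _ :: _ => true
  | _ :: _, [::] => false
  | a :: u', b :: v' => (a < b)%N || ((a == b) && lex_lt u' v')
  end.

Section Tree.
Context {R : realType} {Om : Type} (X : seq nat -> Om -> \bar R) (om : Om).

(* birth time, computed along the reversed node (last letter first):
   B(ui) = B(u) + sum_{j=1}^{i} X(uj)  (0-based: children 0..i) *)
Fixpoint birth_rev (r : seq nat) : \bar R :=
  match r with
  | [::] => 0
  | i :: r' => birth_rev r' + \sum_(j < i.+1) X (rcons (rev r') j) om
  end.

Definition birth (u : seq nat) : \bar R := birth_rev (rev u).

Definition precedes (y x : seq nat) : bool :=
  (birth y < birth x) || ((birth y == birth x) && lex_lt y x).

Definition tree_at (t : R) : set (seq nat) := [set x | birth x <= t%:E].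

Definition has_at_least (k : nat) (E : set (seq nat)) : Prop :=
  exists s : seq (seq nat), [/\ uniq s, size s = k & forall x, x \in s -> E x].

Definition tau (k : nat) : \bar R :=
  ereal_inf [set t%:E | t in [set t : R | (0 <= t)%R /\ has_at_least k (tree_at t)]].

Definition tree_at_tau (k : nat) : set (seq nat) :=
  [set x | birth x <= tau k /\ birth x < +oo].

Definition first_k (k : nat) : set (seq nat) :=
  [set x | tree_at_tau k x /\
           ~ has_at_least k [set y | tree_at_tau k y /\ precedes y x]].

Definition tree_inf : set (seq nat) := [set x | exists k, first_k k x].

End Tree.

Section Prob.
Context {R : realType} {d : measure_display} {T : measurableType d}
  {dS : measure_display} {S : measurableType dS} (P : probability T R).

Definition cyl (X : seq nat -> T -> \bar R) (W : seq nat -> T -> S)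
  (u : seq nat) (n : nat) (B : set S) (A : nat -> set (\bar R)) : set T :=
  [set om | B (W u om) /\ forall j, (j < n)%N -> A j (X (rcons u j) om)].

(* the pairs ((X(uj))_j, W_u), u in U_infinity, are i.i.d.: checked on
   cylinder events (a pi-system generating the product sigma-algebra),
   for any finite list of distinct nodes *)
Definition iid_pairs (X : seq nat -> T -> \bar R) (W : seq nat -> T -> S) : Prop :=
  forall (s : seq (seq nat)), uniq s ->
  forall (n : nat) (B : nat -> set S) (A : nat -> nat -> set (\bar R)),
    (forall k, measurable (B k)) -> (forall k j, measurable (A k j)) ->
    P [set om | forall k, (k < size s)%N -> cyl X W (nth [::] s k) n (B k) (A k) om]
    = \prod_(k < size s) P (cyl X W [::] n (B k) (A k)).

Definition cond_exp_version (W : T -> S) (Z : T -> \bar R) (g : S -> \bar R) : Prop :=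
  [/\ measurable_fun setT g, (forall w, 0 <= g w) &
      forall B, measurable B ->
        \int[P]_(om in W @^-1` B) Z om = \int[P]_(om in W @^-1` B) g (W om)].

Definition cond_prob_version (W : T -> S) (E : set T) (g : S -> \bar R) : Prop :=
  cond_exp_version W (fun om => (\1_E om : R)%:E) g.

Definition cond_indep_given (W : T -> S) (Z : nat -> T -> \bar R) : Prop :=
  forall (n : nat) (A : nat -> set (\bar R)), (forall j, measurable (A j)) ->
  forall g : nat -> S -> \bar R,
    (forall j, (j < n)%N -> cond_prob_version W (Z j @^-1` A j) (g j)) ->
  forall B, measurable B ->
    P (W @^-1` B `&` [set om | forall j, (j < n)%N -> A j (Z j om)])
    = \int[P]_(om in W @^-1` B) \prod_(j < n) g j (W om).

End Prob.

(* Main.v *)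
(** An infinite path of the genealogical tree along which the explosion time
    theta is approached, while no node of the path has produced all its children
    by time theta, is excluded by a first moment bound.  Follow the path and call
    a step a record when the child's rank n is at least the current record m
    (initially a large K).  After a record n at the node v, everything on the path
    is born before the family of v is complete, so the remaining birth time is at
    most the tail sum of X(vj) over j > n.  Exponential tilting with parameter
    lambda_m between records gives each step the factor
    exp(-lambda_m P_n) if n < m, and exp(-lambda_m P_m + lambda_n tail_n) if
    n >= m; along such a path the product of these factors stays above
    exp(-lambda_K theta).  In a record step P_m and tail_n are conditionally
    independent given the weight, so the expected factor is at most
    L_m(P_m) M_n(Y_n), where L_m(Z) stands for E[exp(-lambda_m Z)].  With the
    potential L_m(P_m) attached to the state m, the expected total weight is
    multiplied at each generation by at most
    sum_(n < m) L_m(P_n) + sum_(n >= m) M_n(Y_n) L_n(P_n), which for m large is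
    below 1 by Assumption A.  Hence the total weight of the tree is almost surely
    finite, and only finitely many nodes can have a weight bounded below.

    If no node completes its family by time theta, such a path exists by Koenig's
    lemma applied to the nodes with infinitely many descendants born by time t,
    for every t > theta. *)

From HB Require Import structures.
Require Import Defs.
From mathcomp Require Import all_boot all_order all_algebra.
From mathcomp Require Import finmap.
From mathcomp Require Import all_classical all_reals all_analysis measurable_realfun.
From mathcomp Require Import ring lra.
Import GRing.Theory Num.Theory Order.TTheory.
Set Implicit Arguments.
Unset Strict Implicit.
Unset Printing Implicit Defensive.
Import numFieldNormedType.Exports.
Local Open Scope classical_set_scope.
Local Open Scope ring_scope.
Local Open Scope ereal_scope.

(** * From rectangles to products of functions *)

Section Transfer.
Import HBNNSimple.

(** Simple functions increasing to [f] and monotone convergence reduce the integral to those with an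
    indicator in place of [f], the only ones that the hypotheses control. *)
Let approx_integral (R : realType) (d dD : measure_display) (T : measurableType d)
    (D : measurableType dD) (P : {measure set T -> \bar R}) (Y : T -> D) (g : T -> R)
    (f : D -> R) (mf : measurable_fun setT (EFin \o f)) :
  measurable_fun setT Y -> measurable_fun setT g -> (forall x, (0 <= g x)%R) ->
  (forall y, (0 <= f y)%R) ->
  (fun n => \sum_(y \in range (nnsfun_approx measurableT mf n))
     y%:E * \int[P]_x (\1_(nnsfun_approx measurableT mf n @^-1` [set y]) (Y x) * g x)%:E)
  @ \oo --> \int[P]_x (f (Y x) * g x)%:E.
Proof.
move=> mY mg g0 f0.
pose h := nnsfun_approx measurableT mf.
have mh n : measurable_fun setT (fun x => (h n (Y x) * g x)%:E).
  apply/measurable_EFinP; apply: measurable_funM => //.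
  exact: measurableT_comp.
have hge n z : (0 <= h n z)%R by [].
have h0 n x : 0 <= (h n (Y x) * g x)%:E by rewrite lee_fin mulr_ge0.
have H : (fun n => \int[P]_x (h n (Y x) * g x)%:E) @ \oo --> \int[P]_x (f (Y x) * g x)%:E.
  have fg x : (f (Y x) * g x)%:E = lim ((h n (Y x) * g x)%:E @[n --> \oo]).
    apply/esym/cvg_lim => //.
    rewrite EFinM; under eq_fun do rewrite EFinM.
    apply: cvgeZr => //.
    exact: (cvg_nnsfun_approx measurableT mf (fun y _ => f0 y) (x := Y x)).
  under eq_integral do rewrite fg.
  apply: cvg_monotone_convergence => //.
  move=> x _ a b ab; rewrite lee_fin ler_wpM2r//.
  exact/lefP/nd_nnsfun_approx.
suff E n : \int[P]_x (h n (Y x) * g x)%:E = \sum_(y \in range (h n))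
     y%:E * \int[P]_x (\1_(h n @^-1` [set y]) (Y x) * g x)%:E.
  by apply: cvg_trans H; under eq_fun do rewrite -/h -E.
have mind y : measurable_fun setT (fun x => (\1_(h n @^-1` [set y]) (Y x) * g x)%:E).
  apply/measurable_EFinP; apply: measurable_funM => //.
  by apply: measurableT_comp.
transitivity (\int[P]_x (\sum_(y \in range (h n)) (y%:E * (\1_(h n @^-1` [set y]) (Y x) * g x)%:E))).
  apply: eq_integral => x _.
  rewrite fimfunE EFinM -fsumEFin// ge0_mule_fsuml; last first.
    by move=> y; exact: nnfun_muleindic_ge0.
  by apply: eq_fsbigr => y _; rewrite -!EFinM mulrA.
have ge0 y x : range (h n) y -> 0 <= y%:E * (\1_(h n @^-1` [set y]) (Y x) * g x)%:E.
  by move=> [z _ <-]; rewrite -EFinM lee_fin !mulr_ge0 ?hge.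
(* The truncation at 0 makes the summand nonnegative for all y, not only on the range. *)
transitivity (\int[P]_x (\sum_(y \in range (h n))
    (((fun y => if (0 <= y)%R then y else 0%R) y)%:E *
     (\1_(h n @^-1` [set y]) (Y x) * g x)%:E))).
  apply: eq_integral => x _; apply: eq_fsbigr => y; rewrite inE => -[z _ <-].
  by rewrite ifT// hge.
rewrite ge0_integral_fsum//.
- apply: eq_fsbigr => y; rewrite inE => -[z _ <-]; rewrite ifT ?hge//.
  by rewrite ge0_integralZl// ?lee_fin ?hge// => x _; rewrite lee_fin mulr_ge0.
- by move=> y; apply: emeasurable_funM => //; exact: measurable_cst.
- move=> y x _; case: ifPn => y0; last by rewrite mul0e.
  by rewrite -EFinM lee_fin !mulr_ge0.
Qed.

(** Both sides are limits of sums over the same simple functions, whose values are nonnegative, so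
    the inequality passes term by term. The one-sided form also serves for domination, where no
    equality is available. *)
Lemma le_integral_of_indic (R : realType) (d1 d2 dD : measure_display)
    (T1 : measurableType d1) (T2 : measurableType d2) (D : measurableType dD)
    (P1 : {measure set T1 -> \bar R}) (P2 : {measure set T2 -> \bar R})
    (Y1 : T1 -> D) (Y2 : T2 -> D) (g1 : T1 -> R) (g2 : T2 -> R) :
  measurable_fun setT Y1 -> measurable_fun setT Y2 ->
  measurable_fun setT g1 -> measurable_fun setT g2 ->
  (forall x, (0 <= g1 x)%R) -> (forall x, (0 <= g2 x)%R) ->
  (forall A, measurable A -> \int[P1]_x (\1_A (Y1 x) * g1 x)%:E
                          <= \int[P2]_x (\1_A (Y2 x) * g2 x)%:E) ->
  forall f : D -> R, measurable_fun setT f -> (forall y, (0 <= f y)%R) ->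
  \int[P1]_x (f (Y1 x) * g1 x)%:E <= \int[P2]_x (f (Y2 x) * g2 x)%:E.
Proof.
move=> mY1 mY2 mg1 mg2 g10 g20 le12 f /measurable_EFinP mf f0.
have c1 := approx_integral (P := P1) mf mY1 mg1 g10 f0.
have c2 := approx_integral (P := P2) mf mY2 mg2 g20 f0.
rewrite -(cvg_lim _ c1)// -(cvg_lim _ c2)//.
apply: lee_lim; [by apply/cvg_ex; eexists; exact: c1|by apply/cvg_ex; eexists; exact: c2|].
apply: nearW => n.
apply: lee_fsum => //= y -[z _ <-].
rewrite lee_wpmul2l ?le12//.
by rewrite lee_fin.
Qed.

End Transfer.

(** The factors are released one at a time: [f n] is absorbed into the weights, which leaves
    rectangles in the first [n] coordinates; with these fixed, the last indicator is upgraded to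
    [f n]. *)
Lemma le_integral_of_rectangles (R : realType) (d1 d2 dD : measure_display)
    (T1 : measurableType d1) (T2 : measurableType d2) (D : measurableType dD)
    (P1 : {measure set T1 -> \bar R}) (P2 : {measure set T2 -> \bar R})
    (Y1 : nat -> T1 -> D) (Y2 : nat -> T2 -> D) (n : nat) :
  (forall j, measurable_fun setT (Y1 j)) -> (forall j, measurable_fun setT (Y2 j)) ->
  forall (g1 : T1 -> R) (g2 : T2 -> R),
  measurable_fun setT g1 -> measurable_fun setT g2 ->
  (forall x, (0 <= g1 x)%R) -> (forall x, (0 <= g2 x)%R) ->
  (forall A : nat -> set D, (forall j, measurable (A j)) ->
     \int[P1]_x ((\prod_(j < n) \1_(A j) (Y1 j x)) * g1 x)%:E
     <= \int[P2]_x ((\prod_(j < n) \1_(A j) (Y2 j x)) * g2 x)%:E) ->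
  forall f : nat -> D -> R, (forall j, measurable_fun setT (f j)) ->
  (forall j y, (0 <= f j y)%R) ->
  \int[P1]_x ((\prod_(j < n) f j (Y1 j x)) * g1 x)%:E
  <= \int[P2]_x ((\prod_(j < n) f j (Y2 j x)) * g2 x)%:E.
Proof.
move=> mY1 mY2; elim: n => [|n IH] g1 g2 mg1 mg2 g10 g20 H f mf f0.
  apply: le_trans (le_trans (H (fun=> setT) (fun=> measurableT)) _);
    by rewrite le_eqVlt; apply/orP; left; apply/eqP/eq_integral => x _; rewrite !big_ord0.
under eq_integral do rewrite big_ord_recr/= -mulrA.
under [X in _ <= X]eq_integral do rewrite big_ord_recr/= -mulrA.
have mfY1 j : measurable_fun setT (fun x => f j (Y1 j x)) by exact: measurableT_comp.
have mfY2 j : measurable_fun setT (fun x => f j (Y2 j x)) by exact: measurableT_comp.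
apply: (IH (fun x => f n (Y1 n x) * g1 x)%R (fun x => f n (Y2 n x) * g2 x)%R) => //.
- exact: measurable_funM.
- exact: measurable_funM.
- by move=> x; rewrite mulr_ge0.
- by move=> x; rewrite mulr_ge0.
move=> A mA.
under eq_integral do rewrite mulrCA.
under [X in _ <= X]eq_integral do rewrite mulrCA.
apply: (le_integral_of_indic (mY1 n) (mY2 n)
  (g1 := fun x => (\prod_(j < n) \1_(A j) (Y1 j x) * g1 x)%R)
  (g2 := fun x => (\prod_(j < n) \1_(A j) (Y2 j x) * g2 x)%R)) => //.
- apply: measurable_funM => //; apply: measurable_prod => i _.
  by apply: measurableT_comp => //; exact: mY1.
- apply: measurable_funM => //; apply: measurable_prod => i _.
  by apply: measurableT_comp => //; exact: mY2.
- by move=> x; rewrite mulr_ge0// prodr_ge0.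
- by move=> x; rewrite mulr_ge0// prodr_ge0.
move=> B mB; set C := fun j => if j == n then B else A j.
have E (U : Type) (Y : nat -> U -> D) (g : U -> R) x :
    (\1_B (Y n x) * (\prod_(j < n) \1_(A j) (Y j x) * g x))%R =
    (\prod_(j < n.+1) \1_(C j) (Y j x) * g x)%R.
  rewrite big_ord_recr/= {2}/C eqxx mulrA; congr (_ * _)%R.
  rewrite mulrC; congr (_ * _)%R.
  by apply: eq_bigr => i _; rewrite /C ltn_eqF.
under eq_integral do rewrite E.
under [X in _ <= X]eq_integral do rewrite E.
by apply: H => j; rewrite /C; case: ifP.
Qed.

Lemma prod_indic (R : realType) (T : Type) (n : nat) (E : nat -> set T) (x : T) :
  (\prod_(k < n) \1_(E k) x = \1_[set y | forall k, (k < n)%N -> E k y] x :> R)%R.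
Proof.
have [h|h] := pselect (forall k, (k < n)%N -> E k x).
  rewrite [RHS]indicE mem_set// big1// => k _.
  by rewrite indicE mem_set//; exact: h.
rewrite [RHS]indicE memNset//.
have [k kn Ek] : exists2 k, (k < n)%N & ~ E k x.
  apply: contrapT => h'; apply: h => k kn.
  by apply: contrapT => Ek; apply: h'; exists k.
by rewrite (bigD1 (Ordinal kn))//= indicE memNset// mul0r.
Qed.

Lemma measurable_forall_lt (d : measure_display) (T : measurableType d) (n : nat)
    (E : nat -> set T) : (forall k, measurable (E k)) ->
  measurable [set x | forall k, (k < n)%N -> E k x].
Proof.
move=> mE; rewrite (_ : [set _ | _] = \bigcap_(k in `I_n) E k).
  by apply: fin_bigcap_measurable => //; exact: finite_II.
by apply/seteqP; split => x.
Qed.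

(** * Independence of the families of distinct nodes *)

Section Independence.
Context (R : realType) (d : measure_display) (T : measurableType d)
  (dS : measure_display) (S : measurableType dS) (P : probability T R)
  (X : seq nat -> T -> \bar R) (W : seq nat -> T -> S).
Hypothesis mX : forall u, measurable_fun setT (X u).
Hypothesis iid : iid_pairs P X W.

Let Y (s : seq (seq nat)) k j : T -> \bar R := X (rcons (nth [::] s k) j).

Let mY s k j : measurable_fun setT (Y s k j). Proof. exact: mX. Qed.

Let rectangle_bound s (N : nat) (A : nat -> nat -> set (\bar R)) : uniq s ->
  (forall k j, measurable (A k j)) ->
  \int[P]_om (\prod_(k < size s) \prod_(j < N) \1_(A k j) (Y s k j om))%:E
  = \prod_(k < size s) \int[P]_om (\prod_(j < N) \1_(A k j) (X [:: j : nat] om))%:E.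
Proof.
move=> us mA.
pose C k := [set om | forall j, (j < N)%N -> (Y s k j @^-1` A k j) om].
have mC k : measurable (C k).
  by apply: measurable_forall_lt => j; rewrite -[X in measurable X]setTI; exact: mY.
transitivity (P [set om | forall k, (k < size s)%N -> C k om]).
  rewrite -[X in _ = P X]setIT -integral_indic//; last exact: measurable_forall_lt.
  apply: eq_integral => om _; rewrite -prod_indic; congr EFin.
  by apply: eq_bigr => k _; rewrite -prod_indic; apply: eq_bigr.
have := iid us N (fun=> measurableT) mA.
rewrite (_ : [set om | _] = [set om | forall k, (k < size s)%N -> C k om]); last first.
  apply/seteqP; split => om h k ks; first by have [_] := h k ks.
  by split=> // j jn; exact: h.
move=> ->; apply: eq_bigr => k _.
rewrite (_ : cyl _ _ _ _ _ _ = [set om | forall j, (j < N)%N -> (X [:: j] @^-1` A k j) om]); last first.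
  by apply/seteqP; split => om; [case|].
rewrite -[X in P X = _]setIT -integral_indic//; last first.
  by apply: measurable_forall_lt => j; rewrite -[X in measurable X]setTI; exact: mX.
by apply: eq_integral => om _; rewrite -prod_indic.
Qed.

(** All nodes use the same number [N] of children because the cylinders of [iid_pairs] do. Finite
    means let the product over the other nodes be treated as a real constant. *)
Lemma iid_prod_le (s : seq (seq nat)) (N : nat) (f : nat -> nat -> \bar R -> R) : uniq s ->
  (forall k j, measurable_fun setT (f k j)) -> (forall k j x, (0 <= f k j x)%R) ->
  (forall k, \int[P]_om (\prod_(j < N) f k j (X [:: j : nat] om))%:E < +oo) ->
  \int[P]_om (\prod_(k < size s) \prod_(j < N) f k j (X (rcons (nth [::] s k) j) om))%:E
  <= \prod_(k < size s) \int[P]_om (\prod_(j < N) f k j (X [:: j : nat] om))%:E.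
Proof.
move=> us.
(* Indicators are replaced by functions one node at a time; [r] nodes are done. *)
suff H r : (r <= size s)%N -> forall f : nat -> nat -> \bar R -> R,
    (forall k j, measurable_fun setT (f k j)) -> (forall k j x, (0 <= f k j x)%R) ->
    (forall k, \int[P]_om (\prod_(j < N) f k j (X [:: j : nat] om))%:E < +oo) ->
    (forall k, (r <= k < size s)%N -> exists A : nat -> set (\bar R),
       forall j, measurable (A j) /\ f k j = \1_(A j)) ->
    \int[P]_om (\prod_(k < size s) \prod_(j < N) f k j (Y s k j om))%:E
    <= \prod_(k < size s) \int[P]_om (\prod_(j < N) f k j (X [:: j : nat] om))%:E.
  move=> mf f0 fy; apply: (H (size s)) => // k; by case: ltngtP.
elim: r => [|r IH] rs {}f mf f0 fy fI.
  have /choice[A hA] : forall k, exists A : nat -> set (\bar R), (k < size s)%N ->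
      forall j, measurable (A j) /\ f k j = \1_(A j).
    move=> k; have [ks|ks] := boolP (k < size s)%N; last by exists (fun=> set0).
    by have [A ?] := fI k ks; exists A.
  pose B k j := if (k < size s)%N then A k j else set0.
  have mB k j : measurable (B k j).
    by rewrite /B; case: ifPn => // ks; have [] := hA k ks j.
  have := rectangle_bound N us mB; rewrite le_eqVlt => h; apply/orP; left; apply/eqP.
  have E (k : 'I_(size s)) j : f k j = \1_(B k j).
    by rewrite /B ltn_ord; have [_ ->] := hA k (ltn_ord k) j.
  under eq_integral do under eq_bigr do under eq_bigr do rewrite E.
  rewrite h; apply: eq_bigr => k _; apply: eq_integral => om _; congr EFin.
  by apply: eq_bigr => j _; rewrite E.
pose i0 := Ordinal rs.
pose C := \prod_(k < size s | k != i0) \int[P]_om (\prod_(j < N) f k j (X [:: j : nat] om))%:E.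
pose g1 om := (\prod_(k < size s | k != i0) \prod_(j < N) f k j (Y s k j om))%R.
have mfX k j : measurable_fun setT (fun om => f k j (X [:: j] om)).
  by apply: measurableT_comp => //; exact: mX.
have mg1 : measurable_fun setT g1.
  rewrite /g1; under eq_fun do rewrite -big_filter.
  apply: measurable_prod => k _; apply: measurable_prod => j _.
  by apply: measurableT_comp => //; exact: mY.
have g10 om : (0 <= g1 om)%R by rewrite prodr_ge0// => k _; rewrite prodr_ge0.
have I0 (h : nat -> \bar R -> R) : (forall j x, 0 <= h j x)%R ->
    0 <= \int[P]_om (\prod_(j < N) h j (X [:: j : nat] om))%:E.
  by move=> h0; apply: integral_ge0 => om _; rewrite lee_fin prodr_ge0.
have C0 : 0 <= C by apply: prode_ge0 => k _; exact: I0.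
have Cfin : C \is a fin_num.
  by apply: prode_fin_num => k _; rewrite ge0_fin_numE ?fy// I0.
have Cc (h : nat -> \bar R -> R) : (forall j, measurable_fun setT (h j)) -> (forall j x, 0 <= h j x)%R ->
    (\int[P]_om (\prod_(j < N) h j (X [:: j : nat] om))%:E) * C =
    \int[P]_om ((\prod_(j < N) h j (X [:: j : nat] om)) * fine C)%:E.
  move=> mh h0; under [RHS]eq_integral do rewrite EFinM fineK//.
  rewrite ge0_integralZr//.
    apply/measurable_EFinP; apply: measurable_prod => j _.
    by apply: measurableT_comp => //; exact: mX.
  by move=> om _; rewrite lee_fin prodr_ge0.
(* Node [r] is isolated: the other nodes enter as the weight [g1] on the left and as the constant
   weight [fine C] on the right. *)
rewrite (bigD1 i0)//= -/C Cc//; under eq_integral do rewrite (bigD1 i0)//= -/(g1 _).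
apply: (le_integral_of_rectangles (Y1 := Y s r) (Y2 := fun j => X [:: j]) _ _ _ (g2 := fun=> fine C)) => //.
- by move=> x; rewrite fine_ge0.
move=> A mA.
(* With indicators at node [r], only [r] nodes carry general functions, so the induction hypothesis
   applies. *)
pose f' k := if k == r then (fun j => \1_(A j)) else f k.
have E (k : 'I_(size s)) : k != i0 -> f' k = f k.
  by move=> ki0; rewrite /f' ifF//; apply: contraNF ki0 => /eqP kr; apply/eqP/val_inj.
rewrite -(Cc (fun j => \1_(A j)))//.
have E0 : f' r = (fun j => \1_(A j)) by rewrite /f' eqxx.
have -> : (\int[P]_om (\prod_(j < N) \1_(A j) (X [:: j : nat] om))%:E) * C =
    \prod_(k < size s) \int[P]_om (\prod_(j < N) f' k j (X [:: j : nat] om))%:E.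
  by rewrite (bigD1 i0)//= E0; congr (_ * _); apply: eq_bigr => k ki0; rewrite E.
have -> : \int[P]_om (\prod_(j < N) \1_(A j) (Y s r j om) * g1 om)%:E =
    \int[P]_om (\prod_(k < size s) \prod_(j < N) f' k j (Y s k j om))%:E.
  apply: eq_integral => om _; rewrite (bigD1 i0)//= E0; congr ((_ * _)%:E).
  by apply: eq_bigr => k ki0; rewrite E.
apply: IH (ltnW rs) _ _ _ _ _.
- by move=> k j; rewrite /f'; case: ifP.
- by move=> k j x; rewrite /f'; case: ifP.
- move=> k; rewrite /f'; case: ifP => // _.
  apply: (@le_lt_trans _ _ (\int[P]_om 1)); last first.
    by rewrite integral_cst// mul1e (le_lt_trans (probability_le1 P _)) ?ltry.
  apply: ge0_le_integral => //.
  + by move=> om _; rewrite lee_fin prodr_ge0.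
  + apply/measurable_EFinP; apply: measurable_prod => j _.
    by apply: measurableT_comp => //; exact: mX.
  + by move=> om _; rewrite lee_fin (prod_indic R N (fun j => X [:: j] @^-1` A j)) indicE; case: (_ \in _).
- move=> k /andP[rk ks]; rewrite /f'; case: eqP => [_|/eqP kr]; first by exists A.
  by apply: fI; rewrite ltn_neqAle eq_sym kr rk.
Qed.

End Independence.

(** * Existence of conditional probabilities given the weight *)

Section ConditionalVersions.
Context (R : realType) (d : measure_display) (T : measurableType d)
  (dS : measure_display) (S : measurableType dS) (P : probability T R)
  (W : {mfun T >-> S}) (E : set T) (mE : measurable E).

(** Its density with respect to the law of [W] is the conditional probability of [E] given [W]. *)
Definition law_on : set S -> \bar R := pushforward (mrestr P mE) W.

Let law_on0 : law_on set0 = 0. Proof. exact: measure0. Qed.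

Let law_on_ge0 A : 0 <= law_on A. Proof. exact: measure_ge0. Qed.

Let law_on_sigma_additive : semi_sigma_additive law_on.
Proof. exact: measure_semi_sigma_additive. Qed.

HB.instance Definition _ := isMeasure.Build _ _ _ law_on
  law_on0 law_on_ge0 law_on_sigma_additive.

Let law_on_fin : fin_num_fun law_on.
Proof.
move=> A mA; rewrite ge0_fin_numE// (le_lt_trans (probability_le1 P _)) ?ltry//.
by apply: measurableI => //; rewrite -[X in measurable X]setTI; exact: measurable_funP.
Qed.

HB.instance Definition _ := Measure_isFinite.Build _ _ _ law_on law_on_fin.

(** By Radon-Nikodym. Existence matters because [cond_indep_given] speaks about versions that have
    to be supplied. The density is finite everywhere, so [fine] loses nothing. *)
Lemma cond_prob_version_mfun : exists g : S -> R,
  [/\ measurable_fun setT g, (forall w, 0 <= g w)%R &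
      cond_prob_version P W E (EFin \o g)].
Proof.
pose mu : probability S R := distribution P W.
pose nu : {finite_measure set S -> \bar R} := law_on.
have dom : nu `<< mu.
  apply/null_content_dominatesP => A mA /eqP muA; apply/eqP.
  rewrite -measure_le0 -(eqP muA); apply: le_measure; rewrite ?inE.
  - apply: measurableI => //; rewrite -[X in measurable X]setTI; exact: measurable_funP.
  - rewrite -[X in measurable X]setTI; exact: measurable_funP.
  - exact: subIsetl.
pose g := Radon_Nikodym_SigmaFinite.f nu mu.
have g0 := Radon_Nikodym_SigmaFinite.f_ge0 dom.
have gf := Radon_Nikodym_SigmaFinite.f_fin_num dom.
have gi := Radon_Nikodym_SigmaFinite.f_integrable dom.
have gE w : (fine (g w))%:E = g w by rewrite fineK.
have mg : measurable_fun setT g by exact: measurable_int gi.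
exists (fine \o g); split.
- by apply: measurableT_comp => //; exact: fine_measurable.
- by move=> w; rewrite fine_ge0.
split.
- by rewrite (_ : _ \o _ = g)//; apply/funext => w /=.
- by move=> w /=; rewrite gE.
move=> B mB.
have mWB : measurable (W @^-1` B).
  rewrite -[X in measurable X]setTI; exact: measurable_funP.
rewrite integral_indic//.
under [RHS]eq_integral do rewrite /= gE.
rewrite setIC -[LHS]/(nu B) (Radon_Nikodym_SigmaFinite.f_integral dom mB).
rewrite /mu /distribution ge0_integral_pushforward//.
- exact: measurable_funTS.
Qed.

End ConditionalVersions.

Lemma cond_prob_version_exists (R : realType) (d : measure_display) (T : measurableType d)
    (dS : measure_display) (S : measurableType dS) (P : probability T R)
    (W : T -> S) (E : set T) : measurable_fun setT W -> measurable E ->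
  exists g : S -> R, [/\ measurable_fun setT g, (forall w, 0 <= g w)%R &
      cond_prob_version P W E (EFin \o g)].
Proof.
move=> mW mE.
pose Wmix := isMeasurableFun.Build _ _ _ _ _ mW.
pose WW : {mfun T >-> S} := HB.pack W Wmix.
exact: (cond_prob_version_mfun P WW mE).
Qed.

(** * Conditional independence given the weight *)

(** Two separated blocks of children, [j < m] and [n <= j < n + l], become one product over an
    initial segment, with neutral factors in the gap. *)
Lemma prod_window (R : comNzRingType) (m n l : nat) (a b : nat -> R) : (m <= n)%N ->
  (\prod_(j < n + l) (if (j < m)%N then a j else if (n <= j)%N then b (j - n)%N else 1)
   = \prod_(j < m) a j * \prod_(j < l) b j)%R.
Proof.
move=> mn.
rewrite -(big_mkord xpredT (fun j => if (j < m)%N then a j else if (n <= j)%N then b (j - n)%N else 1%R)).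
rewrite (@big_cat_nat _ _ _ n) ?leq_addr//= (@big_cat_nat _ _ _ m)//=.
rewrite [X in (_ * X * _)%R]big_nat_cond [X in (_ * X * _)%R]big1 ?mulr1; last first.
  by move=> j /andP[/andP[mj jn] _]; rewrite ltnNge mj/= leqNgt jn.
congr (_ * _)%R.
  by rewrite big_mkord; apply: eq_bigr => j _; rewrite ltn_ord.
rewrite -{1}[n]add0n big_addn addKn big_mkord; apply: eq_bigr => j _.
by rewrite leq_addl addnK ltnNge (leq_trans mn (leq_addl _ _)).
Qed.

Lemma integral_mul_indic (R : realType) (d : measure_display) (T : measurableType d)
    (P : {measure set T -> \bar R}) (D : set T) (h : T -> R) :
  \int[P]_(x in D) (h x)%:E = \int[P]_x (\1_D x * h x)%:E.
Proof.
rewrite integral_mkcond; apply: eq_integral => x _.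
by rewrite patchE indicE; case: ifP => _; rewrite ?mul1r ?mul0r.
Qed.

Lemma EFin_prod (R : realType) (I : Type) (s : seq I) (h : I -> R) :
  (\prod_(i <- s) h i)%:E = \prod_(i <- s) (h i)%:E.
Proof. by elim/big_ind2: _ => // x1 x2 y1 y2 <- <-; rewrite EFinM. Qed.

Section ConditionalIndependence.
Context (R : realType) (d : measure_display) (T : measurableType d)
  (dS : measure_display) (S : measurableType dS) (P : probability T R)
  (W : T -> S) (Z : nat -> T -> \bar R).
Hypothesis mW : measurable_fun setT W.
Hypothesis mZ : forall j, measurable_fun setT (Z j).
Hypothesis ci : cond_indep_given P W Z.

Let mZA j A : measurable A -> measurable (Z j @^-1` A).
Proof. by move=> mA; rewrite -[X in measurable X]setTI; exact: mZ. Qed.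

Let mWB B : measurable B -> measurable (W @^-1` B).
Proof. by move=> mB; rewrite -[X in measurable X]setTI; exact: mW. Qed.

Let ci_real (n : nat) (A : nat -> set (\bar R)) (g : nat -> S -> R) (B : set S) :
  (forall j, measurable (A j)) -> measurable B ->
  (forall j, cond_prob_version P W (Z j @^-1` A j) (EFin \o g j)) ->
  \int[P]_x (\1_B (W x) * \prod_(j < n) \1_(A j) (Z j x))%:E =
  \int[P]_x (\1_B (W x) * \prod_(j < n) g j (W x))%:E.
Proof.
move=> mA mB hg.
transitivity (\int[P]_(x in W @^-1` B) (\prod_(j < n) g j (W x))%:E); last first.
  by rewrite integral_mul_indic.
have := ci mA (fun j (_ : (j < n)%N) => hg j) mB.
under [in RHS]eq_integral do rewrite -EFin_prod.
move=> <-; rewrite -integral_mul_indic setIC.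
have mE : measurable [set om | forall j, (j < n)%N -> (Z j @^-1` A j) om].
  by apply: measurable_forall_lt => j; exact: mZA.
rewrite -integral_indic//; last exact: mWB.
by apply: eq_integral => x _; rewrite -prod_indic.
Qed.

Let version_setT j : cond_prob_version P W (Z j @^-1` setT) (EFin \o (fun=> 1%R)).
Proof.
by split=> [|//|B mB]; [exact: measurable_cst|by apply: eq_integral => x _; rewrite /= indicT].
Qed.

(** The last hypothesis bounds the conditional mean of the second block given [W] by [M]. A
    rectangle in the first block is replaced by its conditional probability [G], the bound is
    applied with the weight [G (W x)], and [G (W x)] is integrated back. *)
Lemma cond_indep_prod_le (m n l : nat) (f F : nat -> \bar R -> R) (M : R) :
  (m <= n)%N -> (0 <= M)%R ->
  (forall j, measurable_fun setT (f j)) -> (forall j y, (0 <= f j y)%R) ->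
  (forall j, measurable_fun setT (F j)) -> (forall j y, (0 <= F j y)%R) ->
  (forall B, measurable B ->
     \int[P]_x (\1_B (W x) * \prod_(j < l) F j (Z (n + j)%N x))%:E
     <= \int[P]_x (\1_B (W x) * M)%:E) ->
  \int[P]_x (\prod_(j < m) f j (Z j x) * \prod_(j < l) F j (Z (n + j)%N x))%:E
  <= \int[P]_x (\prod_(j < m) f j (Z j x) * M)%:E.
Proof.
move=> mn M0 mf f0 mF F0 HM.
have mFZ (h : nat -> \bar R -> R) k : (forall j, measurable_fun setT (h j)) ->
    measurable_fun setT (fun x => \prod_(j < l) h j (Z (k + j)%N x))%R.
  move=> mh; apply: measurable_prod => j _; apply: measurableT_comp => //; exact: mZ.
have mfZ (h : nat -> \bar R -> R) k : (forall j, measurable_fun setT (h j)) ->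
    measurable_fun setT (fun x => \prod_(j < k) h j (Z j x))%R.
  move=> mh; apply: measurable_prod => j _; apply: measurableT_comp => //; exact: mZ.
apply: (le_integral_of_rectangles (Y1 := Z) (Y2 := Z) _ _ _ (g2 := fun=> M)) => //.
- exact: mFZ.
- by move=> x; rewrite prodr_ge0.
move=> A mA.
have /choice[g hg] : forall j, exists g : S -> R, [/\ measurable_fun setT g, (forall w, 0 <= g w)%R &
    cond_prob_version P W (Z j @^-1` A j) (EFin \o g)].
  by move=> j; apply: cond_prob_version_exists => //; exact: mZA.
have mg j : measurable_fun setT (g j) by have [] := hg j.
have g0 j w : (0 <= g j w)%R by have [_ + _] := hg j; exact.
have gv j : cond_prob_version P W (Z j @^-1` A j) (EFin \o g j) by have [] := hg j.
pose G w := (\prod_(j < m) g j w)%R.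
have mG : measurable_fun setT G by apply: measurable_prod => j _.
have G0 w : (0 <= G w)%R by rewrite prodr_ge0.
have EG : \int[P]_x (\prod_(j < m) \1_(A j) (Z j x))%:E = \int[P]_x (G (W x))%:E.
  have := ci_real m mA measurableT gv.
  under eq_integral do rewrite indicT mul1r.
  by under [X in _ = X -> _]eq_integral do rewrite indicT mul1r.
(* Conditionally on the weight, the first rectangle may be replaced by [G]. *)
have claim1 (A' : nat -> set (\bar R)) : (forall j, measurable (A' j)) ->
    \int[P]_x (\prod_(j < l) \1_(A' j) (Z (n + j)%N x) * \prod_(j < m) \1_(A j) (Z j x))%:E
    <= \int[P]_x (\prod_(j < l) \1_(A' j) (Z (n + j)%N x) * G (W x))%:E.
  move=> mA'.
  have /choice[g' hg'] : forall j, exists g : S -> R, [/\ measurable_fun setT g, (forall w, 0 <= g w)%R &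
      cond_prob_version P W (Z (n + j)%N @^-1` A' j) (EFin \o g)].
    by move=> j; apply: cond_prob_version_exists => //; exact: mZA.
  have mg' j : measurable_fun setT (g' j) by have [] := hg' j.
  have g'0 j w : (0 <= g' j w)%R by have [_ + _] := hg' j; exact.
  have gv' j : cond_prob_version P W (Z (n + j)%N @^-1` A' j) (EFin \o g' j) by have [] := hg' j.
  pose G' w := (\prod_(j < l) g' j w)%R.
  have mG' : measurable_fun setT G' by apply: measurable_prod => j _.
  (* Joint factorization of both blocks given the weight; the children in the gap get the full event
     and the version 1. *)
  have win (B : set S) (A0 : nat -> set (\bar R)) (g1 : nat -> S -> R) : measurable B ->
      (forall j, measurable (A0 j)) ->
      (forall j, cond_prob_version P W (Z j @^-1` A0 j) (EFin \o g1 j)) ->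
      \int[P]_x (\1_B (W x) * (\prod_(j < m) \1_(A0 j) (Z j x) * \prod_(j < l) \1_(A' j) (Z (n + j)%N x)))%:E
      = \int[P]_x (\1_B (W x) * (\prod_(j < m) g1 j (W x) * G' (W x)))%:E.
    move=> mB mA0 gv0.
    pose C j := if (j < m)%N then A0 j else if (n <= j)%N then A' (j - n)%N else setT.
    pose gg j := if (j < m)%N then g1 j else if (n <= j)%N then g' (j - n)%N else fun=> 1%R.
    have mC j : measurable (C j) by rewrite /C; case: ifP => // _; case: ifP.
    have E1 x : (\prod_(j < n + l) \1_(C j) (Z j x) =
      \prod_(j < m) \1_(A0 j) (Z j x) * \prod_(j < l) \1_(A' j) (Z (n + j)%N x) :> R)%R.
      rewrite -(prod_window l (fun j => \1_(A0 j) (Z j x)) (fun j => \1_(A' j) (Z (n + j)%N x)) mn).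
      apply: eq_bigr => j _; rewrite /C.
      by case: ifP => // _; case: ifPn => [nj|_]; [rewrite subnKC|rewrite indicT].
    have E2 w : (\prod_(j < n + l) gg j w = \prod_(j < m) g1 j w * G' w)%R.
      rewrite /G' -(prod_window l (fun j => g1 j w) (fun j => g' j w) mn); apply: eq_bigr => j _; rewrite /gg.
      by case: ifP => // _; case: ifP.
    under eq_integral do rewrite -E1.
    under [RHS]eq_integral do rewrite -E2.
    apply: ci_real => // j; rewrite /C /gg; case: ifP => // _; case: ifPn => [nj|_]; last exact: version_setT.
    by rewrite -{1}(subnKC nj).
  have := win setT A g measurableT mA gv.
  under eq_integral do rewrite indicT mul1r mulrC.
  move=> ->.
  under eq_integral do rewrite indicT mul1r -/(G _).
  under [X in _ <= X]eq_integral do rewrite mulrC.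
  apply: (le_integral_of_indic (Y1 := W) (Y2 := W) (g1 := G' \o W)
    (g2 := fun x => (\prod_(j < l) \1_(A' j) (Z (n + j)%N x))%R)) => //.
  - exact: measurableT_comp.
  - exact: (mFZ (fun j => \1_(A' j))).
  - by move=> x; rewrite prodr_ge0.
  - by move=> x; rewrite prodr_ge0.
  move=> B mB; rewrite le_eqVlt; apply/orP; left; apply/eqP.
  (* With a trivial first block, [win] identifies [G'] as the conditional probability of the second
     rectangle. *)
  have w1 := win B (fun=> setT) (fun _ _ => 1%R) mB (fun=> measurableT) version_setT.
  transitivity (\int[P]_x (\1_B (W x) * (\prod_(j < m) 1%R * G' (W x)))%:E).
    by apply: eq_integral => x _; rewrite big1_eq mul1r.
  rewrite -w1; apply: eq_integral => x _; rewrite [X in (_ * (X * _))%R]big1 ?mul1r// => j _.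
  by rewrite indicT.
have claim2 : \int[P]_x (\prod_(j < l) F j (Z (n + j)%N x) * \prod_(j < m) \1_(A j) (Z j x))%:E
    <= \int[P]_x (\prod_(j < l) F j (Z (n + j)%N x) * G (W x))%:E.
  apply: (@le_integral_of_rectangles R _ _ _ T T _ P P (fun j => Z (n + j)%N) (fun j => Z (n + j)%N)
    l _ _ (fun x => \prod_(j < m) \1_(A j) (Z j x))%R (G \o W)) => //.
  - exact: (mfZ (fun j => \1_(A j))).
  - exact: measurableT_comp.
  - by move=> x; rewrite prodr_ge0.
  - by move=> x; exact: G0.
have claim3 : \int[P]_x (G (W x) * \prod_(j < l) F j (Z (n + j)%N x))%:E
    <= \int[P]_x (G (W x) * M)%:E.
  apply: (le_integral_of_indic (Y1 := W) (Y2 := W)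
    (g1 := fun x => (\prod_(j < l) F j (Z (n + j)%N x))%R) (g2 := fun=> M)) => //.
  - exact: mFZ.
  - by move=> x; rewrite prodr_ge0.
apply: (@le_trans _ _ (\int[P]_x (G (W x) * M)%:E)).
  apply: le_trans claim3.
  rewrite (eq_integral _ _ (fun x _ => congr1 EFin (mulrC _ _))).
  by rewrite [leRHS](eq_integral _ _ (fun x _ => congr1 EFin (mulrC _ _))).
have mulM (h : T -> R) : measurable_fun setT h -> (forall x, 0 <= h x)%R ->
    \int[P]_x (h x * M)%:E = (\int[P]_x (h x)%:E) * M%:E.
  move=> mh h0; under eq_integral do rewrite EFinM.
  rewrite ge0_integralZr//; first exact/measurable_EFinP.
  by move=> x _; rewrite lee_fin.
rewrite !mulM//.
- by rewrite EG.
- exact: (mfZ (fun j => \1_(A j))).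
- by move=> x; rewrite prodr_ge0.
- exact: measurableT_comp.
Qed.

End ConditionalIndependence.

(** * Exponential tilting along a path *)

(** The mean of a nonnegative variable is the integral of its tail function, and [expR (lam * _)] is
    increasing, so domination of tails carries over. The indicator of [D] restricts the tail events
    to [D]. *)
Lemma integral_exp_dominated (R : realType) (d : measure_display) (T : measurableType d)
    (P : probability T R) (mu : probability R R) (D : set T) (Z : T -> R) (lam : R) :
  measurable D -> measurable_fun setT Z -> (0 < lam)%R ->
  (forall t : R, P (D `&` [set x | (t < Z x)%R]) <= mu [set y : R | (t < y)%R] * P D) ->
  \int[P]_x (\1_D x * expR (lam * Z x))%:E <= \int[mu]_y (expR (lam * y))%:E * P D.
Proof.
move=> mD mZ lam0 dom.
pose V x := (\1_D x * expR (lam * Z x) : R)%R.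
have mV : measurable_fun setT V.
  apply: measurable_funM => //; apply: measurableT_comp => //.
  exact: measurable_funM.
pose U (y : R) := expR (lam * y).
have mU : measurable_fun setT U.
  by apply: measurableT_comp => //; exact: measurable_funM.
pose Vmix := isMeasurableFun.Build _ _ _ _ _ mV.
pose VV : {RV P >-> R} := HB.pack V Vmix.
pose Umix := isMeasurableFun.Build _ _ _ _ _ mU.
pose UU : {RV mu >-> R} := HB.pack U Umix.
have V0 x : (0 <= VV x)%R by rewrite mulr_ge0// expR_ge0.
have U0 x : (0 <= UU x)%R by rewrite expR_ge0.
have -> : \int[P]_x (V x)%:E = 'E_P[VV] by rewrite expectation_def.
have -> : \int[mu]_y (expR (lam * y))%:E = 'E_mu[UU] by rewrite expectation_def.
rewrite !ge0_expectation_ccdf// -ge0_integralZr//; last first.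
  by apply: measurable_funTS; exact: ccdf_measurable.
apply: ge0_le_integral => //.
- by apply: measurable_funTS; exact: ccdf_measurable.
- apply: measurable_funTS; apply: emeasurable_funM; last exact: measurable_cst.
  exact: ccdf_measurable.
move=> r; rewrite /= in_itv/= andbT => r0.
have EV : ccdf VV r = P (D `&` [set x | (r < expR (lam * Z x))%R]).
  rewrite /ccdf /distribution /pushforward/=; congr (P _).
  apply/seteqP; split => x /=; rewrite in_itv/= andbT /V indicE.
    case: (boolP (x \in D)) => xD; last by rewrite mul0r ltNge r0.
    by rewrite mul1r => rx; split => //; exact/set_mem.
  by move=> [xD rx]; rewrite mem_set// mul1r.
have EU : ccdf UU r = mu [set y : R | (r < expR (lam * y))%R].
  rewrite /ccdf /distribution /pushforward/=; congr (mu _).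
  by apply/seteqP; split => x /=; rewrite in_itv/= andbT.
(* The level 0 has no logarithm: there both conditions on the exponential hold everywhere. *)
rewrite EV EU; move: r0; rewrite le_eqVlt => /predU1P[<-|r0].
  rewrite (_ : [set y : R | _] = setT); last first.
    by apply/seteqP; split => y //= _; exact: expR_gt0.
  rewrite probability_setT mul1e; apply: le_measure; rewrite ?inE//.
  apply: measurableI => //; rewrite (_ : [set x | _] = setT)//.
  by apply/seteqP; split => y //= _; exact: expR_gt0.
have lt_lnE (z : R) : (r < expR (lam * z))%R = (ln r / lam < z)%R.
  by rewrite ltr_pdivrMr// -[RHS]ltr_expR lnK ?posrE// mulrC.
have := dom (ln r / lam)%R.
congr (P (D `&` _) <= mu _ * _).
  by apply/funext => x /=; rewrite lt_lnE.
by apply/funext => x /=; rewrite lt_lnE.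
Qed.

(* [fine +oo = 0]: infinite waiting times, which have probability 0, are dropped. *)
Definition pexp (R : realType) (a : nat -> R) (N : nat) (z : nat -> \bar R) : R :=
  (\prod_(j < N) expR (a j * fine (z j)))%R.

(* Tilting exponents for a step to the child of rank [n] (letter [n.-1]) when the
   current record is [m]: first branch, an ordinary step; second one, a record. *)
Definition alpha (R : realType) (lam : nat -> R) (m n j : nat) : R :=
  if (n < m)%N then (if (j < n)%N then - lam m else 0)%R
  else (if (j < m)%N then - lam m else if (n <= j)%N then lam n else 0)%R.

(** The part of a record step from [m] that does not depend on the rank of the child; it is applied
    to the last node of a path. *)
Definition alpha_last (R : realType) (lam : nat -> R) (m j : nat) : R :=
  (if (j < m)%N then - lam m else 0)%R.

(** The record along the path [u] when it starts from [m]; ranks exceed letters by one. *)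
Definition state (m : nat) (u : seq nat) : nat := foldl (fun m c => maxn m c.+1) m u.

Lemma state_ge m u : (m <= state m u)%N.
Proof.
elim: u m => [|c u IH] m //=.
by apply: leq_trans (IH _); rewrite leq_maxl.
Qed.

Lemma state_take m l u : (state m (take l u) <= state m u)%N.
Proof.
by rewrite -{2}(cat_take_drop l u) /state foldl_cat; exact: state_ge.
Qed.

Lemma state_rcons m u c : state m (rcons u c) = maxn (state m u) c.+1.
Proof. by rewrite /state foldl_rcons. Qed.

Lemma state_nth m l u : (l < size u)%N -> (nth 0 u l < state m u)%N.
Proof.
move=> lu; apply: leq_trans (state_take m l.+1 u).
by rewrite (take_nth 0%N lu) state_rcons leq_maxr.
Qed.

Section Exponents.
Context (R : realType).
Implicit Types (lam : nat -> R) (z : nat -> \bar R).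

Lemma pexp_ge0 (a : nat -> R) N z : (0 <= pexp a N z)%R.
Proof. by rewrite prodr_ge0// => j _; exact: expR_ge0. Qed.

Lemma pexpE (a : nat -> R) N z : pexp a N z = expR (\sum_(j < N) a j * fine (z j))%R.
Proof. by rewrite expR_sum. Qed.

Lemma pexp_prefix (a b : nat -> R) n N z : (n <= N)%N ->
  (forall j, (j < n)%N -> a j = b j) -> (forall j, (n <= j)%N -> a j = 0%R) ->
  pexp a N z = pexp b n z.
Proof.
move=> nN ab a0; rewrite -(subnKC nN) /pexp.
have := prod_window (R := R) (N - n) (fun j => expR (b j * fine (z j))) (fun=> 1%R) (leqnn n).
rewrite big1_eq mulr1 => <-; apply: eq_bigr => j _.
case: ifPn => jn; first by rewrite ab.
by rewrite -leqNgt in jn; rewrite a0// mul0r expR0; case: ifP.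
Qed.

Lemma pexp_alpha_lt lam m n N z : (n < m)%N -> (n <= N)%N ->
  pexp (alpha lam m n) N z = pexp (fun=> - lam m)%R n z.
Proof.
move=> nm nN; apply: pexp_prefix => // j jn; first by rewrite /alpha nm jn.
by rewrite /alpha nm ltnNge jn.
Qed.

Lemma pexp_alpha_last lam m N z : (m <= N)%N ->
  pexp (alpha_last lam m) N z = pexp (fun=> - lam m)%R m z.
Proof.
move=> mN; apply: pexp_prefix => // j jn; first by rewrite /alpha_last jn.
by rewrite /alpha_last ltnNge jn.
Qed.

Lemma pexp_alpha_ge lam m n l z : (m <= n)%N ->
  pexp (alpha lam m n) (n + l) z =
  (pexp (fun=> - lam m)%R m z * pexp (fun=> lam n) l (fun j => z (n + j)%N))%R.
Proof.
move=> mn; rewrite /pexp.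
rewrite -(prod_window l (fun j => expR (- lam m * fine (z j)))
  (fun j => expR (lam n * fine (z (n + j)%N))) mn).
apply: eq_bigr => j _; rewrite /alpha ltnNge mn/=.
case: ifP => // _; case: ifPn => [nj|_]; first by rewrite subnKC.
by rewrite mul0r expR0.
Qed.

Lemma measurable_pexp (d : measure_display) (T : measurableType d) (a : nat -> R) N
    (Z : nat -> T -> \bar R) : (forall j, measurable_fun setT (Z j)) ->
  measurable_fun setT (fun x => pexp a N (Z ^~ x)).
Proof.
move=> mZ; apply: measurable_prod => j _; apply: measurableT_comp => //.
by apply: measurable_funM => //; apply: measurableT_comp.
Qed.

End Exponents.

Section PathExpectation.
Context (R : realType) (d : measure_display) (T : measurableType d)
  (dS : measure_display) (S : measurableType dS) (P : probability T R)
  (X : seq nat -> T -> \bar R) (W : seq nat -> T -> S)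
  (mu : nat -> probability R R) (lam : nat -> R).
Hypothesis mX : forall u, measurable_fun setT (X u).
Hypothesis mW : forall u, measurable_fun setT (W u).
Hypothesis X0 : forall u om, 0 <= X u om.
Hypothesis iid : iid_pairs P X W.
Hypothesis ci : cond_indep_given P (W [::]) (fun i => X [:: i]).
Hypothesis dom : forall (n : nat) (t : R) (B : set S), measurable B ->
  P (W [::] @^-1` B `&` [set om | t%:E < \sum_(n <= i <oo) X [:: i] om])
  <= mu n [set y : R | (t < y)%R] * P (W [::] @^-1` B).
Hypothesis lam0 : forall n, (0 < n)%N -> (0 < lam n)%R.
Hypothesis Mfin : forall n, (0 < n)%N -> \int[mu n]_y (expR (lam n * y))%:E < +oo.

Let mZ j : measurable_fun setT (fun om => X [:: j] om). Proof. exact: mX. Qed.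

Definition lap (m n : nat) : R :=
  fine (\int[P]_om (pexp (fun=> - lam m)%R n (fun j => X [:: j] om))%:E).

Definition mgf (n : nat) : R := fine (\int[mu n]_y (expR (lam n * y))%:E).

Definition factor (m n : nat) : R :=
  (if (n < m)%N then lap m n else lap m m * mgf n)%R.

Lemma pexp_neg_le1 m n om : (0 < m)%N -> (pexp (fun=> - lam m)%R n (fun j => X [:: j] om) <= 1)%R.
Proof.
move=> m0; rewrite pexpE -expR0 ler_expR sumr_le0// => j _.
by rewrite mulNr oppr_le0 mulr_ge0 ?fine_ge0// ltW// lam0.
Qed.

Lemma lapE m n : (0 < m)%N ->
  \int[P]_om (pexp (fun=> - lam m)%R n (fun j => X [:: j] om))%:E = (lap m n)%:E.
Proof.
move=> m0; rewrite fineK// ge0_fin_numE; last first.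
  by apply: integral_ge0 => om _; rewrite lee_fin; exact: pexp_ge0.
apply: (@le_lt_trans _ _ (\int[P]_om 1)).
  apply: ge0_le_integral => //.
  - by move=> om _; rewrite lee_fin pexp_ge0.
  - by apply/measurable_EFinP; exact: measurable_pexp.
  - by move=> om _; rewrite lee_fin pexp_neg_le1.
by rewrite integral_cst// mul1e (le_lt_trans (probability_le1 P _)) ?ltry.
Qed.

Lemma lap_ge0 m n : (0 <= lap m n)%R.
Proof. by rewrite fine_ge0// integral_ge0// => om _; rewrite lee_fin pexp_ge0. Qed.

Lemma mgf_ge0 n : (0 <= mgf n)%R.
Proof. by rewrite fine_ge0// integral_ge0// => om _; rewrite lee_fin expR_ge0. Qed.

Lemma factor_ge0 m n : (0 <= factor m n)%R.
Proof. by rewrite /factor; case: ifP => _; rewrite ?mulr_ge0 ?lap_ge0 ?mgf_ge0. Qed.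

(** Stochastic domination on each event of the weight becomes a bound on an exponential moment, in
    the form that [cond_indep_prod_le] expects. *)
Let tail_le n l (B : set S) : (0 < n)%N -> measurable B ->
  \int[P]_om (\1_B (W [::] om) * pexp (fun=> lam n) l (fun j => X [:: (n + j)%N] om))%:E
  <= \int[P]_om (\1_B (W [::] om) * mgf n)%:E.
Proof.
move=> n0 mB.
pose Z om := (\sum_(j < l) fine (X [:: (n + j)%N] om))%R.
have mZs : measurable_fun setT Z.
  apply: measurable_sum => j; apply: measurableT_comp => //; exact: fine_measurable.
have mD : measurable (W [::] @^-1` B) by rewrite -[X in measurable X]setTI; exact: mW.
(* An infinite waiting time becomes 0 under [fine], which only lowers the left side. *)
have ZS om : (Z om)%:E <= \sum_(n <= i <oo) X [:: i] om.
  apply: (@le_trans _ _ (\sum_(n <= i < n + l) X [:: i] om)); last exact: nneseries_lim_ge.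
  rewrite -{1}[n]add0n big_addn addKn big_mkord /Z -sumEFin; apply: lee_sum => j _.
  by rewrite addnC; case: (X _ om) (X0 [:: (j + n)%N] om) => [r|//|//]; rewrite ?leey.
have key := integral_exp_dominated (P := P) (mu := mu n) (lam := lam n) mD mZs (lam0 n0).
under eq_integral do rewrite pexpE -mulr_sumr.
apply: le_trans (key _) _.
  move=> t; apply: le_trans (dom n t mB); apply: le_measure; rewrite ?inE.
  - apply: measurableI => //; rewrite -[X in measurable X]setTI.
    rewrite (_ : [set x | (t < Z x)%R] = [set x | t%:E < (EFin \o Z) x]); last first.
      by apply/seteqP; split => x /=; rewrite lte_fin.
    by apply: emeasurable_fun_o_infty => //; exact/measurable_EFinP.
  - apply: measurableI => //; rewrite -[X in measurable X]setTI.
    apply: emeasurable_fun_o_infty => //.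
    under eq_fun do rewrite -(nneseries_addn (f := fun i => X [:: i] _))//.
    exact: ge0_emeasurable_sum.
  - by apply: setIS => om /= tZ; apply: lt_le_trans (ZS om); rewrite lte_fin.
rewrite le_eqVlt; apply/orP; left; apply/eqP.
under [RHS]eq_integral do rewrite EFinM.
rewrite ge0_integralZr//.
- have -> : \int[P]_om (\1_B (W [::] om))%:E = P (W [::] @^-1` B).
    by rewrite -[LHS]/(\int[P]_x (\1_(W [::] @^-1` B) x)%:E) integral_indic// setIT.
  rewrite muleC /mgf fineK// ge0_fin_numE ?Mfin//.
  by apply: integral_ge0 => om _; rewrite lee_fin expR_ge0.
- apply/measurable_EFinP; apply: (measurableT_comp _ (mW [::])).
  exact: measurable_indic.
- by rewrite lee_fin mgf_ge0.
Qed.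

(** In a record step [m <= n], so the discounted children [j < m] and the compensating children
    [j >= n] form disjoint blocks, which conditional independence separates. *)
Lemma node_le m n N : (0 < m)%N -> (0 < n)%N -> (maxn m n <= N)%N ->
  \int[P]_om (pexp (alpha lam m n) N (fun j => X [:: j] om))%:E <= (factor m n)%:E.
Proof.
move=> m0 n0; rewrite geq_max => /andP[mN nN].
rewrite /factor; case: ltnP => nm.
  by under eq_integral do rewrite pexp_alpha_lt//; rewrite lapE.
rewrite -(subnKC nN); under eq_integral do rewrite pexp_alpha_ge//.
apply: (@le_trans _ _ (\int[P]_om (pexp (fun=> - lam m)%R m (fun j => X [:: j] om) * mgf n)%:E)).
  have mf (c : R) : measurable_fun setT (fun y : \bar R => expR (c * fine y)).
    apply: measurableT_comp => //; apply: measurable_funM => //; exact: fine_measurable.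
  apply: (cond_indep_prod_le (mW [::]) mZ ci (m := m) (n := n) (l := (N - n)%N)
    (f := fun _ y => expR (- lam m * fine y)) (F := fun _ y => expR (lam n * fine y))) => //.
  - exact: mgf_ge0.
  - by move=> B mB; exact: tail_le.
under eq_integral do rewrite EFinM.
rewrite ge0_integralZr//.
- by rewrite lapE.
- by apply/measurable_EFinP; exact: measurable_pexp.
- by move=> om _; rewrite lee_fin pexp_ge0.
- by rewrite lee_fin mgf_ge0.
Qed.

Lemma node_last_le m N : (0 < m)%N -> (m <= N)%N ->
  \int[P]_om (pexp (alpha_last lam m) N (fun j => X [:: j] om))%:E <= (lap m m)%:E.
Proof. by move=> m0 mN; under eq_integral do rewrite pexp_alpha_last//; rewrite lapE. Qed.

(** Every factor reads only [N] children of its node, as the independence hypothesis concerns finite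
    cylinders. Fatou's lemma later removes the truncation. *)
Definition path_exp (K : nat) (u : seq nat) (N : nat) (om : T) : R :=
  (\prod_(l < size u) pexp (alpha lam (state K (take l u)) (nth 0%N u l).+1) N
     (fun j => X (rcons (take l u) j) om))%R.

Lemma measurable_path_exp K u N : measurable_fun setT (path_exp K u N).
Proof.
by apply: measurable_prod => l _; apply: measurable_pexp => j; exact: mX.
Qed.

Lemma path_exp_ge0 K u N om : (0 <= path_exp K u N om)%R.
Proof. by rewrite prodr_ge0// => l _; rewrite pexp_ge0. Qed.

(** Prefixes of different lengths are distinct nodes, so their families are independent copies of
    the family of the root. *)
Let prefixes_le (u : seq nat) k N (a : nat -> nat -> R) (b : nat -> R) : (k <= (size u).+1)%N ->
  (forall l, (l < k)%N ->
    \int[P]_om (pexp (a l) N (fun j => X [:: j] om))%:E <= (b l)%:E) ->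
  \int[P]_om (\prod_(l < k) pexp (a l) N (fun j => X (rcons (take l u) j) om))%:E
  <= (\prod_(l < k) b l)%:E.
Proof.
move=> ku ab.
pose s := [seq take l u | l <- iota 0 k].
have ss : size s = k by rewrite size_map size_iota.
have us : uniq s.
  rewrite map_inj_in_uniq ?iota_uniq// => i j.
  rewrite !mem_iota !add0n /= => ik jk /(congr1 size).
  by rewrite !size_takel// -ltnS (leq_trans _ ku).
have sn l : (l < k)%N -> nth [::] s l = take l u.
  by move=> lk; rewrite (nth_map 0%N) ?size_iota// nth_iota.
(* [iid_prod_le] asks for finite means at every index; exponent 0 from [k] on gives mean 1. *)
pose a' l := if (l < k)%N then a l else fun=> 0%R.
have := iid_prod_le mX iid (N := N) (f := fun l j y => expR (a' l j * fine y)) us.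
rewrite ss => /(_ _ _ _)/le_trans -/(_ _)/=.
have E : \int[P]_om (\prod_(l < k) pexp (a l) N (fun j => X (rcons (take l u) j) om))%:E =
   \int[P]_om (\prod_(k0 < k) \prod_(j < N) expR (a' k0 j * fine (X (rcons (nth [::] s k0) j) om)))%:E.
  apply: eq_integral => om _; congr EFin; apply: eq_bigr => l _.
  by rewrite sn// /a' ltn_ord.
rewrite E; apply.
- move=> l j; apply: measurableT_comp => //; apply: measurable_funM => //; exact: fine_measurable.
- by move=> *; exact: expR_ge0.
- move=> l; rewrite /a'; case: ifPn => lk; first exact: le_lt_trans (ab l lk) (ltry _).
  under eq_integral do under eq_bigr do rewrite mul0r expR0.
  under eq_integral do rewrite big1_eq.
  by rewrite integral_cst// mul1e (le_lt_trans (probability_le1 P _)) ?ltry.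
rewrite EFin_prod.
pose I (l : 'I_k) := \int[P]_om (\prod_(j < N) expR (a' l j * fine (X [:: j : nat] om)))%:E.
suff /andP[_] : 0 <= \prod_(l < k) I l <= \prod_(l < k) (b l)%:E by [].
elim/big_ind2 : _ => [|x1 x2 y1 y2 /andP[x10 x12] /andP[y10 y12]|l _].
- by rewrite lee01 lexx.
- by rewrite mule_ge0//= lee_pmul.
- rewrite /I /a' ltn_ord; apply/andP; split; last exact: ab.
  by apply: integral_ge0 => om _; rewrite lee_fin; rewrite prodr_ge0// => j _; exact: expR_ge0.
Qed.

Lemma path_exp_le K u N : (0 < K)%N -> (state K u <= N)%N ->
  \int[P]_om (path_exp K u N om)%:E
  <= (\prod_(l < size u) factor (state K (take l u)) (nth 0%N u l).+1)%:E.
Proof.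
move=> K0 uN; apply: (prefixes_le (a := fun l => alpha lam (state K (take l u)) (nth 0%N u l).+1)
  (b := fun l => factor (state K (take l u)) (nth 0%N u l).+1)) => // l lu.
apply: node_le => //; first by rewrite (leq_trans K0)// state_ge.
by rewrite (leq_trans _ uN)// geq_max state_take state_nth.
Qed.

Lemma path_exp_last_le K u N : (0 < K)%N -> (state K u <= N)%N ->
  \int[P]_om (path_exp K u N om *
    pexp (alpha_last lam (state K u)) N (fun j => X (rcons u j) om))%:E
  <= ((\prod_(l < size u) factor (state K (take l u)) (nth 0%N u l).+1)
      * lap (state K u) (state K u))%:E.
Proof.
move=> K0 uN.
pose a l := if (l < size u)%N then alpha lam (state K (take l u)) (nth 0%N u l).+1
            else alpha_last lam (state K u).
pose b l := if (l < size u)%N then factor (state K (take l u)) (nth 0%N u l).+1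
            else lap (state K u) (state K u).
have := prefixes_le (u := u) (k := (size u).+1) (N := N) (a := a) (b := b) (leqnn _).
have -> : (\prod_(l < (size u).+1) b l = (\prod_(l < size u) factor (state K (take l u)) (nth 0%N u l).+1)
      * lap (state K u) (state K u))%R.
  rewrite big_ord_recr/= {2}/b ltnn; congr (_ * _)%R.
  by apply: eq_bigr => l _; rewrite /b ltn_ord.
have E om : (\prod_(l < (size u).+1) pexp (a l) N (fun j => X (rcons (take l u) j) om) =
   path_exp K u N om * pexp (alpha_last lam (state K u)) N (fun j => X (rcons u j) om))%R.
  rewrite big_ord_recr/= {2}/a ltnn take_size; congr (_ * _)%R.
  by apply: eq_bigr => l _; rewrite /a ltn_ord.
under eq_integral do rewrite E.
apply => l; rewrite ltnS leq_eqVlt => /predU1P[->|lu].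
  rewrite /a /b ltnn; apply: node_last_le => //; by rewrite (leq_trans K0)// state_ge.
rewrite /a /b lu; apply: node_le => //; first by rewrite (leq_trans K0)// state_ge.
by rewrite (leq_trans _ uN)// geq_max state_take state_nth.
Qed.

End PathExpectation.

(** * Summability of the weights *)

Section WeightedTree.
Context (R : realType) (fac : nat -> nat -> R) (h : nat -> R) (K : nat) (rho : R).
Hypothesis fac_ge0 : forall m n, (0 <= fac m n)%R.
Hypothesis h_ge0 : forall m, (0 <= h m)%R.
Hypothesis rho_ge0 : (0 <= rho)%R.
Hypothesis rho_lt1 : (rho < 1)%R.
Hypothesis fac_step : forall m N, (K <= m)%N ->
  (\sum_(c < N) fac m c.+1 * h (maxn m c.+1) <= rho * h m)%R.

(** Peeling off the first letter lets the induction over generations run with a varying starting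
    record. *)
Fixpoint weight (m : nat) (u : seq nat) : R :=
  if u is c :: u' then (fac m c.+1 * weight (maxn m c.+1) u')%R else h m.

Lemma weight_ge0 m u : (0 <= weight m u)%R.
Proof. by elim: u m => [|c u IH] m //=; rewrite mulr_ge0. Qed.

Lemma esumZl_le (I : choiceType) (A : set I) (c : R) (a : I -> \bar R) :
  (0 <= c)%R -> (forall i, 0 <= a i) ->
  \esum_(i in A) (c%:E * a i) <= c%:E * \esum_(i in A) a i.
Proof.
move=> c0 a0; apply: ge_ereal_sup => _ [X fX] <-.
rewrite -ge0_mule_fsumr// lee_wpmul2l//.
by apply: ereal_sup_ubound; exists X.
Qed.

(** A generation splits over the first letter; the induction hypothesis at the new record produces
    the potential [h], and [fac_step] contracts it once more. *)
Lemma esum_weight_size_le (k m : nat) : (K <= m)%N ->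
  \esum_(u in [set u : seq nat | size u = k]) (weight m u)%:E <= (rho ^+ k * h m)%:E.
Proof.
elim: k m => [|k IH] m Km.
  rewrite (_ : [set u : seq nat | size u = 0%N] = [set [::]]); last first.
    by apply/seteqP; split => u /=; [move/size0nil|move=> ->].
  by rewrite esum_set1 ?lee_fin//= expr0 mul1r.
rewrite (@reindex_esum R _ _
   ([set: nat] `*`` (fun _ => [set u : seq nat | size u = k])) _
   (fun p : nat * seq nat => p.1 :: p.2)); last first.
  split.
  - by move=> [c u] [_ /= ->].
  - by move=> [c u] [c' u'] _ _ [-> ->].
  - by move=> [|c u]//= [su]; exists (c, u).
rewrite -(@esum_esum R _ _ setT (fun _ => [set u : seq nat | size u = k])
  (fun c u => (weight m (c :: u))%:E)); last by move=> c u _ _; rewrite lee_fin weight_ge0.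
have e0 c : 0 <= \esum_(j in [set u : seq nat | size u = k]) (weight m (c :: j))%:E.
  by apply: esum_ge0 => u _; rewrite lee_fin weight_ge0.
rewrite -nneseries_esumT//; apply: lime_le; first exact: is_cvg_nneseries.
apply: nearW => N; rewrite big_mkord.
apply: (@le_trans _ _ (\sum_(c < N) (rho ^+ k * (fac m c.+1 * h (maxn m c.+1)))%:E)).
  apply: lee_sum => c _.
  apply: (@le_trans _ _ ((fac m c.+1)%:E *
    \esum_(u in [set u : seq nat | size u = k]) (weight (maxn m c.+1) u)%:E)).
    under eq_esum do rewrite /= EFinM.
    by apply: esumZl_le => // u; rewrite lee_fin weight_ge0.
  rewrite mulrCA EFinM lee_wpmul2l ?lee_fin//.
  by apply: IH; rewrite (leq_trans Km)// leq_maxl.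
rewrite sumEFin lee_fin -mulr_sumr exprSr -mulrA ler_wpM2l ?exprn_ge0//.
exact: fac_step.
Qed.

Lemma esum_weight_lty : \esum_(u in [set: seq nat]) (weight K u)%:E < +oo.
Proof.
rewrite (_ : [set: seq nat] = \bigcup_(k in [set: nat]) [set u : seq nat | size u = k]); last first.
  by apply/seteqP; split => u // _; exists (size u).
rewrite esum_bigcupT; last 2 first.
- by move=> i j _ _ [u [/= <- <-]].
- by move=> u; rewrite lee_fin weight_ge0.
rewrite -nneseries_esumT; last first.
  by move=> k; apply: esum_ge0 => u _; rewrite lee_fin weight_ge0.
apply: (@le_lt_trans _ _ ((h K / (1 - rho))%:E)); last exact: ltry.
apply: lime_le.
  by apply: is_cvg_nneseries => k _ _; apply: esum_ge0 => u _; rewrite lee_fin weight_ge0.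
apply: nearW => N.
apply: (@le_trans _ _ (\sum_(0 <= k < N) (rho ^+ k * h K)%:E)).
  by apply: lee_sum => k _; exact: esum_weight_size_le.
rewrite sumEFin lee_fin -mulr_suml mulrC ler_wpM2l//.
have r1 : (0 < 1 - rho)%R by rewrite subr_gt0.
rewrite -[(_^-1)%R]mul1r ler_pdivlMr// big_mkord mulrC -[X in (X * _)%R]opprB mulNr.
by rewrite -subrX1 opprB gerBl exprn_ge0.
Qed.

End WeightedTree.

(** * Sums over the countable set of nodes *)

Section CountableSums.
Context (R : realType).

(** Turns a sum over nodes into a series, which can be integrated term by term; numbers that code no
    node contribute 0. *)
Definition on_code (a : seq nat -> \bar R) (n : nat) : \bar R :=
  oapp a 0 (pickle_inv n).

Lemma nneseries_on_code (a : seq nat -> \bar R) : (forall u, 0 <= a u) ->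
  \sum_(n <oo) on_code a n = \esum_(u in [set: seq nat]) a u.
Proof.
move=> a0.
have c0 n : 0 <= on_code a n by rewrite /on_code; case: pickle_inv.
rewrite nneseries_esumT//.
transitivity (\esum_(n in range (@choice.pickle (seq nat))) on_code a n).
  rewrite [RHS]esum_mkcond; apply: eq_esum => n _.
  case: ifPn => //; rewrite notin_setE => hn; rewrite /on_code.
  have := @pickle_invK (seq nat) n; case: (pickle_inv n) => //= u e.
  by exfalso; apply: hn; exists u.
rewrite esum_image; first by apply: eq_esum => u _; rewrite /on_code pickleK_inv.
by move=> u v _ _; exact: (pcan_inj choice.pickleK).
Qed.

Lemma esum_lty_infinitely_small (a : seq nat -> \bar R) (v : nat -> seq nat) (e : R) :
  (forall u, 0 <= a u) -> \esum_(u in [set: seq nat]) a u < +oo ->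
  injective v -> (0 < e)%R -> exists k, a (v k) < e%:E.
Proof.
move=> a0 fin vI e0; apply: contrapT => /forallNP H.
have av k : e%:E <= a (v k) by rewrite leNgt; apply/negP.
have s0 : 0 <= \esum_(u in [set: seq nat]) a u by exact: esum_ge0.
have le : \sum_(k <oo) a (v k) <= \esum_(u in [set: seq nat]) a u.
  rewrite nneseries_esumT// -(esum_image setT v); last by move=> i j _ _; exact: vI.
  by rewrite esum_mkcond; apply: le_esum => u _; case: ifP.
set s := \esum_(u in _) _ in fin le s0.
have sf : s \is a fin_num by rewrite ge0_fin_numE.
(* So many terms, each at least [e], exceed the whole sum. *)
pose N := (Num.truncn (fine s / e)).+1.
have : (N%:R * e)%:E <= s.
  apply: le_trans le; apply: (le_trans _ (nneseries_lim_ge N _)) => //.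
  apply: (@le_trans _ _ (\sum_(0 <= k < N) e%:E)); last exact: lee_sum.
  by rewrite sumEFin lee_fin sumr_const_nat subn0 mulr_natl.
rewrite -[s]fineK// lee_fin leNgt -ltr_pdivrMr// => /negP; apply.
exact: truncnS_gt.
Qed.

(** The integral of the sum is at most the sum of the bounds, and an integrable function is finite
    almost everywhere. *)
Lemma ae_esum_lty (d : measure_display) (T : measurableType d) (P : probability T R)
    (V : seq nat -> T -> \bar R) (b : seq nat -> \bar R) :
  (forall u, measurable_fun setT (V u)) -> (forall u x, 0 <= V u x) ->
  (forall u, \int[P]_x V u x <= b u) -> \esum_(u in [set: seq nat]) b u < +oo ->
  {ae P, forall x, \esum_(u in [set: seq nat]) V u x < +oo}.
Proof.
move=> mV V0 Vb bfin.
have b0 u : 0 <= b u by apply: le_trans (Vb u); exact: integral_ge0.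
have mc n : measurable_fun setT (fun x => on_code (V ^~ x) n).
  by rewrite /on_code; case: pickle_inv => [u|]//=; exact: measurable_cst.
have c0 n x : 0 <= on_code (V ^~ x) n.
  by rewrite /on_code; case: pickle_inv => /=.
have mS : measurable_fun setT (fun x => \sum_(n <oo) on_code (V ^~ x) n).
  exact: ge0_emeasurable_sum.
have : P.-integrable setT (fun x => \sum_(n <oo) on_code (V ^~ x) n).
  apply/integrableP; split => //.
  under eq_integral.
    move=> x _; rewrite gee0_abs; last by apply: nneseries_ge0.
    over.
  rewrite integral_nneseries//.
  apply: le_lt_trans bfin; rewrite -nneseries_on_code//.
  apply: lee_nneseries => n; first by move=> *; exact: integral_ge0.
  move=> _; rewrite /on_code; case: pickle_inv => [u|]//=; last by rewrite integral0.
move/(integrable_ae measurableT).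
apply: filterS => x /(_ Logic.I).
by rewrite nneseries_on_code// ge0_fin_numE// esum_ge0.
Qed.

End CountableSums.

(** * Infinite stars and infinite paths *)

Lemma lex_lt_irr u : lex_lt u u = false.
Proof. by elim: u => [|a u IH] //=; rewrite ltnn eqxx IH. Qed.

Lemma has_at_least_infinite (k : nat) (E : set (seq nat)) : infinite_set E -> has_at_least k E.
Proof.
move=> /(infinite_set_fset k)[B BE Bk].
exists (take k (enum_fset B)); split.
- exact/take_uniq/fset_uniq.
- by rewrite size_takel.
- by move=> x /mem_take xB; apply: BE.
Qed.

Lemma has_at_least_finite (k : nat) (s : seq (seq nat)) (E : set (seq nat)) :
  (E `<=` [set` s]) -> has_at_least k E -> (k <= size s)%N.
Proof. by move=> Es [t [ut <- tE]]; apply: uniq_leq_size => // x /tE /Es. Qed.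

Section RealBirths.
Context (R : realType) (T : Type) (X : seq nat -> T -> \bar R) (om : T).
Hypothesis X_ge0 : forall u, 0 <= X u om.
Hypothesis X_fin : forall u j, X (rcons u j) om < +oo.

Definition psum (u : seq nat) (n : nat) : R := (\sum_(j < n) fine (X (rcons u j) om))%R.

Definition rbirth (u : seq nat) : R := fine (birth X om u).

Let x_ge0 u : (0 <= fine (X u om))%R. Proof. exact: fine_ge0. Qed.

Let xE u j : (fine (X (rcons u j) om))%:E = X (rcons u j) om.
Proof. by rewrite fineK// ge0_fin_numE. Qed.

Lemma psumE u n : (psum u n)%:E = \sum_(j < n) X (rcons u j) om.
Proof. by rewrite -sumEFin; apply: eq_bigr => j _. Qed.

Lemma psum_ge0 u n : (0 <= psum u n)%R. Proof. by rewrite sumr_ge0. Qed.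

Lemma psum_le u n p : (n <= p)%N -> (psum u n <= psum u p)%R.
Proof.
move=> /subnKC <-; elim: (p - n)%N => [|l IH]; first by rewrite addn0.
by rewrite addnS /psum big_ord_recr/= (le_trans IH)// lerDl.
Qed.

Lemma birth_rcons u i : birth X om (rcons u i) = birth X om u + \sum_(j < i.+1) X (rcons u j) om.
Proof. by rewrite /birth rev_rcons/= revK. Qed.

Lemma birthE u : birth X om u = (rbirth u)%:E.
Proof.
suff [r ur] : exists r : R, birth X om u = r%:E by rewrite /rbirth ur.
elim/last_ind: u => [|u i [r ur]]; first by exists 0%R.
by exists (r + psum u i.+1)%R; rewrite birth_rcons ur -psumE.
Qed.

Lemma rbirth_nil : rbirth [::] = 0%R. Proof. by []. Qed.

Lemma rbirth_rcons u i : rbirth (rcons u i) = (rbirth u + psum u i.+1)%R.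
Proof. by rewrite {1}/rbirth birth_rcons birthE -psumE. Qed.

Lemma rbirth_prefix u w : (rbirth u <= rbirth (u ++ w))%R.
Proof.
elim/last_ind: w => [|w i IH]; first by rewrite cats0.
by rewrite -rcons_cat rbirth_rcons (le_trans IH)// lerDl psum_ge0.
Qed.

Lemma rbirth_ge0 u : (0 <= rbirth u)%R.
Proof. exact: (rbirth_prefix [::] u). Qed.

(** Let [k] count the nodes born no later than [y]. Then [tau k] is the birth time of [y], and fewer
    than [k] nodes precede [y], since [y] does not precede itself. *)
Lemma mem_tree_inf y : finite_set [set z | (rbirth z <= rbirth y)%R] -> tree_inf X om y.
Proof.
move=> /finite_fsetP[A EA].
have memA z : (z \in A) = (rbirth z <= rbirth y)%R.
  by apply/idP/idP => h; [have : [set` A] z by []; rewrite -EA|have : [set` A] z by rewrite -EA].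
pose k := #|` A|.
have yA : y \in A by rewrite memA.
have notk E : (E `<=` [set z | (rbirth z <= rbirth y)%R /\ z <> y]) -> ~ has_at_least k E.
  move=> Ey hk.
  have : (k <= #|` (A `\ y)%fset|)%N.
    apply: (has_at_least_finite _ hk) => z /Ey [zy zny] /=; rewrite !inE memA zy andbT.
    exact/eqP.
  by rewrite /k (cardfsD1 y) yA add1n ltnn.
have tau_k : tau X om k = (rbirth y)%:E.
  apply/eqP; rewrite eq_le; apply/andP; split.
    apply: ereal_inf_lbound; exists (rbirth y) => //; split; first exact: rbirth_ge0.
    exists (enum_fset A); split => //; first exact: fset_uniq.
    by move=> z; rewrite memA /tree_at/= birthE lee_fin.
  apply: le_ereal_inf_tmp => _ [t [t0 tk] <-]; rewrite lee_fin leNgt; apply/negP => ty.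
  apply: notk tk => z; rewrite /tree_at/= birthE lee_fin => zt; split.
    exact: le_trans zt (ltW ty).
  by move=> zy; move: zt; rewrite zy leNgt ty.
exists k; split.
  by split; rewrite /= birthE ?tau_k ?ltry.
apply: notk => z [[+ _] zy]; rewrite birthE tau_k lee_fin => zley; split => // E.
by move: zy; rewrite E /precedes ltxx eqxx lex_lt_irr.
Qed.

Hypothesis root_bounded : exists C, forall n, (psum [::] n <= C)%R.
Hypothesis tail_pos : forall u n, exists j, (n <= j)%N /\ (0 < fine (X (rcons u j) om))%R.

Hypothesis no_infinite_path : forall (v : nat -> seq nat) (c : nat -> nat) (theta : R),
  v 0%N = [::] -> (forall k, v k.+1 = rcons (v k) (c k)) ->
  (forall k, rbirth (v k) <= theta)%R ->
  (forall k, exists N, theta < rbirth (v k) + psum (v k) N)%R -> False.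

Let big : set R := [set t | infinite_set [set u | (rbirth u <= t)%R]].

(** The explosion time: infinitely many nodes are born by any later time, only finitely many by any
    earlier one. *)
Let theta := inf big.

Let infinite_le (A B : set (seq nat)) : A `<=` B -> infinite_set A -> infinite_set B.
Proof. by move=> AB; apply: contra_not; exact: sub_finite_set. Qed.

Let big_neq0 : big !=set0.
Proof.
have [C hC] := root_bounded; exists C; rewrite /big/=.
apply: (@infinite_le (range (fun i : nat => [:: i]))).
  by move=> _ [i _ <-] /=; rewrite -[ [:: i] ]/(rcons [::] i) rbirth_rcons rbirth_nil add0r.
move=> /(@finite_preimage _ _ _ (fun i : nat => [:: i]))-/(_ _).
rewrite preimage_range => /(_ _)/infinite_nat; apply.
by move=> i j _ _ [].
Qed.

Let big_lb : has_lbound big.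
Proof.
exists 0%R => t ht; have [s [_ s1 sb]] := has_at_least_infinite 1 ht.
case: s s1 sb => [//|z s] _ /(_ z); rewrite mem_head => /(_ isT)/=.
exact: le_trans (rbirth_ge0 z).
Qed.

Let big_gt t : (theta < t)%R -> big t.
Proof.
move=> /(inf_lt big_neq0)[t' bt' t't].
by apply: infinite_le bt' => u /= /le_trans; apply; exact: ltW.
Qed.

Let finite_lt y : (rbirth y < theta)%R -> finite_set [set z | (rbirth z <= rbirth y)%R].
Proof.
move=> yt; apply: contrapT => h.
have : (theta <= rbirth y)%R by exact: (inf_lbound big_lb).
by rewrite leNgt yt.
Qed.

(** Times strictly after [theta] are used because infinitely many descendants need not be born by
    [theta] itself. *)
Let heavy u := forall t, (theta < t)%R ->
  infinite_set [set y | (rbirth y <= t)%R /\ prefix u y].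

Let heavy_nil : heavy [::].
Proof. by move=> t /big_gt; apply: infinite_le => u /= ut; rewrite prefix0s. Qed.

Let heavy_le u : heavy u -> (rbirth u <= theta)%R.
Proof.
move=> hu; rewrite leNgt; apply/negP => tu.
have [t1 t2] := midf_lt tu.
have [s [_ s1 sb]] := has_at_least_infinite 1 (hu _ t1).
case: s s1 sb => [//|z s] _ /(_ z); rewrite mem_head => /(_ isT)[zt].
move=> /prefixP[w zE]; have := rbirth_prefix u w; rewrite -zE => /le_trans /(_ zt).
by rewrite leNgt t2.
Qed.

(** The step of Koenig's lemma. Shortly after [theta] only the first [N] children of [u] can be
    born; if none of them were heavy, they would have finitely many descendants in all by a common
    time [t > theta], and so would [u]. *)
Let heavy_child u : (exists N, theta < rbirth u + psum u N)%R -> heavy u ->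
  exists c, heavy (rcons u c).
Proof.
move=> [N /midf_lt[]]; set t0 := (_ / _)%R => t0l t0r hu.
apply: contrapT => /forallNP noheavy.
pose F c t := finite_set [set y | (rbirth y <= t)%R /\ prefix (rcons u c) y].
have Fle c t t' : (t <= t')%R -> F c t' -> F c t.
  by move=> tt'; apply: sub_finite_set => y [yt yp]; split => //; exact: le_trans tt'.
have hF c : exists2 t, (theta < t)%R & F c t.
  by have /existsNP[t /not_implyP[tt /contrapT ft]] := noheavy c; exists t.
have common M : exists t, [/\ (theta < t)%R, (t <= t0)%R & forall c, (c < M)%N -> F c t].
  elim: M => [|M [t [tt tt0 tF]]]; first by exists t0.
  have [t' tt' Ft'] := hF M; exists (Num.min t t'); split.
  - by rewrite lt_min tt.
  - by rewrite ge_min tt0.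
  - move=> c; rewrite ltnS leq_eqVlt => /predU1P[->|cN].
      by apply: Fle Ft'; rewrite ge_min lexx orbT.
    by apply: Fle (tF c cN); rewrite ge_min lexx.
have [t [tt tt0 tF]] := common N.
apply: (hu t tt).
apply: (@sub_finite_set _ _ ([set u] `|`
  \bigcup_(c in `I_N) [set y | (rbirth y <= t)%R /\ prefix (rcons u c) y])).
  move=> y [yt /prefixP[[|c w] yE]]; first by left; rewrite yE cats0.
  have yE' : y = rcons u c ++ w by rewrite cat_rcons.
  right; exists c => /=; last by split => //; rewrite yE' prefix_prefix.
  rewrite ltnNge; apply/negP => Nc.
  have : (rbirth (rcons u c) <= t0)%R.
    by apply: le_trans tt0; apply: le_trans yt; rewrite yE'; exact: rbirth_prefix.
  rewrite leNgt rbirth_rcons => /negP; apply; apply: lt_le_trans t0r _.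
  by rewrite lerD2l psum_le// ltnW.
by rewrite finite_setU; split => //; apply: bigcup_finite.
Qed.

(** Either some node completes its family by [theta], or every heavy node has a heavy child and
    [no_infinite_path] excludes the resulting path. *)
Lemma exists_infinite_star : exists u, tree_inf X om u /\
  forall N, exists i, (N <= i)%N /\ tree_inf X om (rcons u i).
Proof.
have [u hu] : exists u, forall N, (rbirth u + psum u N <= theta)%R.
  apply: contrapT => /forallNP hno.
  have hN u : exists N, (theta < rbirth u + psum u N)%R.
    have /existsNP[N hN] := hno u; exists N; by rewrite ltNge; apply/negP.
  have /choice[f hf] : forall u, exists c, heavy u -> heavy (rcons u c).
    move=> u; have [h|h] := pselect (heavy u); last by exists 0%N.
    by have [c hc] := heavy_child (hN u) h; exists c.
  pose v := fix v k := if k is k'.+1 then rcons (v k') (f (v k')) else [::].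
  have hv k : heavy (v k) by elim: k => [|k IH]; [exact: heavy_nil|exact: hf].
  by apply: (no_infinite_path (v := v) (c := fun k => f (v k)) (theta := theta)) => // k; exact/heavy_le/hv.
(* A later sibling with positive waiting time makes the birth strictly earlier than [theta]; only
   finitely many nodes are born by then, as [mem_tree_inf] requires. *)
have lt_theta i : (rbirth (rcons u i) < theta)%R.
  have [j [ij xj]] := tail_pos u i.+1.
  apply: lt_le_trans (hu j.+1); rewrite rbirth_rcons ltrD2l.
  by rewrite {2}/psum big_ord_recr/= (le_lt_trans (psum_le u ij))// ltrDl.
exists u; split.
  apply/mem_tree_inf/finite_lt/(le_lt_trans _ (lt_theta 0%N)).
  by rewrite rbirth_rcons lerDl psum_ge0.
by move=> N; exists N; split => //; exact/mem_tree_inf/finite_lt.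
Qed.

End RealBirths.

Lemma take_rcons_lt (T : Type) l (u : seq T) c : (l <= size u)%N -> take l (rcons u c) = take l u.
Proof. by move=> lu; rewrite -cats1 takel_cat. Qed.

(** * Lower bound for the tilted product along an infinite path *)

Section PathLowerBound.
Context (R : realType) (d : measure_display) (T : measurableType d)
  (X : seq nat -> T -> \bar R) (om : T) (lam : nat -> R) (K : nat).
Hypothesis X_ge0 : forall u, 0 <= X u om.
Hypothesis X_fin : forall u j, X (rcons u j) om < +oo.
Hypothesis lam_ge0 : forall n, (0 < n)%N -> (0 <= lam n)%R.
Hypothesis K_gt0 : (0 < K)%N.

Lemma path_exp_rcons u c N : path_exp X lam K (rcons u c) N om =
  (path_exp X lam K u N om *
   pexp (alpha lam (state K u) c.+1) N (fun j => X (rcons u j) om))%R.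
Proof.
rewrite /path_exp size_rcons big_ord_recr/=; congr (_ * _)%R.
  apply: eq_bigr => l _; rewrite take_rcons_lt ?nth_rcons ?ltn_ord//.
  exact: ltnW.
by rewrite take_rcons_lt// take_size nth_rcons ltnn eqxx.
Qed.

Lemma pexp_psum (a : R) n u : pexp (fun=> a) n (fun j => X (rcons u j) om) = expR (a * psum X om u n).
Proof. by rewrite pexpE -mulr_sumr. Qed.

Context (v : nat -> seq nat) (c : nat -> nat) (theta : R).
Hypothesis v0 : v 0%N = [::].
Hypothesis vS : forall k, v k.+1 = rcons (v k) (c k).
Hypothesis v_le : forall k, (rbirth X om (v k) <= theta)%R.
Hypothesis v_star : forall k, exists N, (theta < rbirth X om (v k) + psum X om (v k) N)%R.

Lemma size_path k : size (v k) = k.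
Proof. by elim: k => [|k IH]; rewrite ?v0// vS size_rcons IH. Qed.

Lemma path_inj : injective v.
Proof. by move=> i j /(congr1 size); rewrite !size_path. Qed.

(** The exponent records the time left until [theta], charged at the rate of the current record. An
    ordinary step updates it exactly. At a record, the [m] discounted waiting times end by [theta],
    and [N] is large enough for the truncated tail to run past [theta], which pays for the new
    rate. *)
Lemma path_exp_lower k : exists N0, forall N, (N0 <= N)%N ->
  (expR (- lam K * theta + lam (state K (v k)) * (theta - rbirth X om (v k)))
   <= path_exp X lam K (v k) N om)%R.
Proof.
elim: k => [|k [N0 IH]].
  exists 0%N => N _; rewrite v0 rbirth_nil subr0 mulNr addNr expR0.
  by rewrite /path_exp big_ord0.
have [N1 hN1] := v_star k.
exists (maxn N0 (maxn N1 (c k).+1)) => N.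
rewrite !geq_max => /and3P[N0N N1N cN].
rewrite vS path_exp_rcons state_rcons.
have b' : rbirth X om (rcons (v k) (c k)) = (rbirth X om (v k) + psum X om (v k) (c k).+1)%R.
  exact: rbirth_rcons.
have bt : (rbirth X om (rcons (v k) (c k)) <= theta)%R by rewrite -vS.
have {}IH := IH N N0N.
set m := state K (v k) in IH *; set n := (c k).+1 in b' bt cN *.
set p := psum X om (v k) in b' hN1 *.
have m0 : (0 < m)%N by exact: leq_trans K_gt0 (state_ge _ _).
apply: le_trans (ler_wpM2r (pexp_ge0 _ _ _) IH).
have [nm|mn] := ltnP n m.
  rewrite pexp_alpha_lt// pexp_psum -/p -expRD ler_expR b'.
  by rewrite le_eqVlt; apply/orP; left; apply/eqP; ring.
rewrite -(subnKC cN) pexp_alpha_ge// pexp_psum -/p.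
set tl := pexp _ _ _.
have tlE : tl = expR (lam n * (p N - p n)).
  rewrite /tl pexpE -mulr_sumr; congr (expR (_ * _)%R).
  rewrite /p /psum -[in RHS](subnKC cN) big_split_ord/= addrAC.
  rewrite [X in (X + _)%R](_ : _ = 0%R) ?add0r//; exact: subrr.
rewrite tlE -!expRD ler_expR.
have pm : (p m <= p n)%R by exact: psum_le.
have pN : (p N1 <= p N)%R by exact: psum_le.
have lm : (0 <= lam m * (theta - rbirth X om (v k) - p m))%R.
  rewrite mulr_ge0 ?lam_ge0//; move: bt; rewrite b'; lra.
have ln : (0 <= lam n * (p N - p n - (theta - rbirth X om (rcons (v k) (c k)))))%R.
  rewrite mulr_ge0 ?lam_ge0// b'; lra.
lra.
Qed.

End PathLowerBound.

Lemma measurable_expeR (R : realType) : measurable_fun [set: \bar R] (@expeR R).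
Proof.
rewrite (_ : @expeR R = fun y => (\1_[set +oo%E] y)%:E * +oo +
    (\1_(~` [set -oo%E; +oo%E]) y * expR (fine y))%:E).
  apply: emeasurable_funD.
    apply: emeasurable_funM; last exact: measurable_cst.
    by apply/measurable_EFinP; exact: measurable_indic.
  apply/measurable_EFinP/measurable_funM.
    by apply: measurable_indic; apply/measurableC/measurableU; exact: emeasurable_set1.
  by apply: measurableT_comp => //; exact: fine_measurable.
apply/funext => -[r| |] /=.
- by rewrite !indicE memNset// mem_set ?mul0e ?add0e ?mul1r//= => -[].
- by rewrite !indicE mem_set// memNset/= ?mul1e ?mul0r ?adde0//; apply; right.
- by rewrite !indicE memNset// memNset/= ?mul0e ?mul0r ?adde0//; apply; left.
Qed.

Lemma ae_forall_node (R : realType) (d : measure_display) (T : measurableType d)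
    (P : {measure set T -> \bar R}) (Q : seq nat -> T -> Prop) :
  (forall u, {ae P, forall x, Q u x}) -> {ae P, forall x, forall u, Q u x}.
Proof.
move=> h.
have : {ae P, forall x, forall n : nat, oapp (fun u => Q u x) True (pickle_inv n)}.
  by apply: ae_foralln => n; case: pickle_inv => [u|] /=; [exact: h|exact: aeW].
by apply: filterS => x hx u; have := hx (choice.pickle u); rewrite pickleK_inv.
Qed.

(** * Almost sure properties of the waiting times *)

Section AlmostSure.
Context (R : realType) (d : measure_display) (T : measurableType d)
  (dS : measure_display) (S : measurableType dS) (P : probability T R)
  (X : seq nat -> T -> \bar R) (W : seq nat -> T -> S).
Hypothesis mX : forall u, measurable_fun setT (X u).
Hypothesis X0 : forall u om, 0 <= X u om.
Hypothesis iid : iid_pairs P X W.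

Lemma children_same_law (u : seq nat) (N : nat) (A : nat -> set (\bar R)) :
  (forall j, measurable (A j)) ->
  P [set om | forall j, (j < N)%N -> A j (X (rcons u j) om)] =
  P [set om | forall j, (j < N)%N -> A j (X [:: j] om)].
Proof.
move=> mA.
have := @iid [:: u] isT N (fun=> setT) (fun=> A) (fun=> measurableT) (fun=> mA).
rewrite big_ord1 => h.
rewrite (_ : [set om | _] = [set om | forall k, (k < size [:: u])%N ->
  cyl X W (nth [::] [:: u] k) N setT A om]); last first.
  apply/seteqP; split => om /= hom; first by case.
  by have [] := hom 0%N isT.
rewrite h; congr (P _); apply/seteqP; split => om /=; first by case.
by move=> hom; split.
Qed.

Let msum n : measurable_fun setT (fun om => \sum_(n <= i <oo) X [:: i] om).
Proof.
under eq_fun do rewrite -(nneseries_addn (f := fun i => X [:: i] _))//.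
exact: ge0_emeasurable_sum.
Qed.

Let measurable_preX u (A : set (\bar R)) : measurable A -> measurable (X u @^-1` A).
Proof. by move=> mA; rewrite -[X in measurable X]setTI; exact: mX. Qed.

(** [mu0] lives on the reals, so its tail function tends to 0, and the dominated sum is infinite
    with probability 0. *)
Lemma root_sum_lty (mu0 : probability R R) :
  (forall t : R, P [set om | t%:E < \sum_(0 <= i <oo) X [:: i] om]
     <= mu0 [set y : R | (t < y)%R]) ->
  {ae P, forall om, \sum_(0 <= i <oo) X [:: i] om < +oo}.
Proof.
move=> dom.
have mE : measurable [set om | \sum_(0 <= i <oo) X [:: i] om = +oo].
  rewrite (_ : [set _ | _] = (fun om => \sum_(0 <= i <oo) X [:: i] om) @^-1` [set +oo])//.
  by rewrite -[X in measurable X]setTI; exact: msum.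
exists [set om | \sum_(0 <= i <oo) X [:: i] om = +oo]; split => //; last first.
  by move=> om /= /negP; rewrite -leNgt leye_eq => /eqP.
pose idmix := isMeasurableFun.Build _ _ _ _ _ (@measurable_id _ R setT).
pose I : {RV mu0 >-> R} := HB.pack (@id R) idmix.
apply/eqP; rewrite -measure_le0.
have lim := cvg_ccdfy0 I; rewrite -[leRHS](cvg_lim _ lim)//.
apply: lime_ge; first by apply/cvg_ex; exists 0.
apply: nearW => t.
have -> : ccdf I t = mu0 [set y : R | (t < y)%R].
  rewrite /ccdf /distribution /pushforward/=; congr (mu0 _).
  by apply/seteqP; split => x /=; rewrite in_itv/= andbT.
apply: le_trans (dom t); apply: le_measure; rewrite ?inE//.
  by rewrite -[X in measurable X]setTI; apply: emeasurable_fun_o_infty => //; exact: msum.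
by move=> om /= ->; exact: ltry.
Qed.

Lemma children_lty : {ae P, forall om, \sum_(0 <= i <oo) X [:: i] om < +oo} ->
  {ae P, forall om, forall u j, X (rcons u j) om < +oo}.
Proof.
move=> [N [mN PN hN]].
apply: ae_forall_node => u; apply: ae_foralln => j.
(* A cylinder that constrains only child [j]; it has the same probability at [u] and at the root. *)
pose A i := if i == j then [set +oo] else [set: \bar R].
have mA i : measurable (A i) by rewrite /A; case: ifP.
exists [set om | forall i, (i < j.+1)%N -> A i (X (rcons u i) om)]; split.
- by apply: (@measurable_forall_lt _ _ j.+1 (fun i => X (rcons u i) @^-1` A i)) => i; exact: measurable_preX.
- apply: etrans (children_same_law u j.+1 mA) _; apply/eqP.
  rewrite -measure_le0 -PN; apply: le_measure; rewrite ?inE//.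
    by apply: (@measurable_forall_lt _ _ j.+1 (fun i => X [:: i] @^-1` A i)) => i; exact: measurable_preX.
  move=> om /(_ j (ltnSn j)); rewrite /A eqxx/= => Xj; apply: hN => /=.
  by rewrite (nneseries_pinfty _ _ Xj).
- move=> om /= /negP; rewrite -leNgt leye_eq => /eqP Xj i _.
  by rewrite /A; case: eqP => // ->.
Qed.

(** That all waiting times from some rank on vanish is a decreasing limit of cylinders, each as
    likely at [u] as at the root, where the limit is null. *)
Lemma children_tail_pos :
  (forall n, (0 < n)%N -> {ae P, forall om, 0 < \sum_(n <= i <oo) X [:: i] om}) ->
  {ae P, forall om, forall u n, exists j, (n <= j)%N /\ 0 < X (rcons u j) om}.
Proof.
move=> hpos; apply: ae_forall_node => u; apply: ae_foralln => n.
(* [hpos] starts at 1, hence the shift to [n.+1], which also covers [n = 0]. *)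
pose A i := if (n.+1 <= i)%N then [set 0] else [set: \bar R].
have mA i : measurable (A i) by rewrite /A; case: ifP.
pose D v N := [set om | forall i, (i < N)%N -> A i (X (rcons v i) om)].
have mD v N : measurable (D v N).
  by apply: (@measurable_forall_lt _ _ N (fun i => X (rcons v i) @^-1` A i)) => i; exact: measurable_preX.
have mcap v : measurable (\bigcap_N D v N) by exact: bigcapT_measurable.
exists (\bigcap_N D u N); split => //.
  have [E [mE PE hE]] := hpos n.+1 isT.
  have PD : P (\bigcap_N D [::] N) = 0.
    apply/eqP; rewrite -measure_le0 -PE; apply: le_measure; rewrite ?inE//.
    move=> om h; apply: hE => /=; apply/negP; rewrite -leNgt.
    rewrite eseries0// => i ni _.
    by have := h i.+1 I i (ltnSn i); rewrite /A ni.
  apply/eqP; rewrite -measure_le0 -PD.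
  have lim : P (D [::] N) @[N --> \oo] --> P (\bigcap_N D [::] N).
    apply: nonincreasing_cvg_mu => //.
      by rewrite (le_lt_trans (probability_le1 P _)) ?ltry.
    move=> i j ij; apply/subsetPset => om h k ki; apply: h; exact: leq_trans ij.
  rewrite -(cvg_lim _ lim)//; apply: lime_ge; first by apply/cvg_ex; eexists; exact: lim.
  apply: nearW => N; rewrite -(children_same_law u N mA).
  by apply: le_measure; rewrite ?inE//; [exact: (mD u N)|move=> om; apply].
move=> om /= h N _ i iN; rewrite /A; case: ifP => // ni /=.
apply: contrapT => Xi; apply: h; exists i; split; first exact: ltnW.
by rewrite lt_neqAle X0 andbT; apply/eqP => /esym.
Qed.

End AlmostSure.

(** * Contraction of the potential for large records *)

Section Contraction.
Context (R : realType) (d : measure_display) (T : measurableType d)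
  (dS : measure_display) (S : measurableType dS) (P : probability T R)
  (X : seq nat -> T -> \bar R) (W : seq nat -> T -> S)
  (mu : nat -> probability R R) (lam : nat -> R) (g : nat -> S -> \bar R).
Hypothesis mX : forall u, measurable_fun setT (X u).
Hypothesis X0 : forall u om, 0 <= X u om.
Hypothesis Xfin : {ae P, forall om, forall u j, X (rcons u j) om < +oo}.
Hypothesis mu_pos : forall n, mu n [set y : R | (0 < y)%R] = 1.
Hypothesis lam0 : forall n, (0 < n)%N -> (0 < lam n)%R.
Hypothesis lam_inc : forall n, (0 < n)%N -> (lam n < lam n.+1)%R.
Hypothesis lam_y : lam @ \oo --> +oo%R.
Hypothesis hg : forall n, (0 < n)%N ->
  cond_exp_version P (W [::])
    (fun om => expeR (- ((lam n)%:E * \sum_(i < n) X [:: (i : nat)] om))) (g n).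
Hypothesis hsum : \sum_(1 <= n <oo)
  ((\int[mu n]_y (expR (lam n * y))%:E) * \int[P]_om g n (W [::] om)) < +oo.
Hypothesis hsup : \int[P]_om ereal_sup
  ([set ((k.+1)%:R)%:E | k in [set k | X [:: k] om = 0]] `|` [set 0]) < 1.

Let x j om : R := fine (X [:: j] om).

Local Notation lap := (lap P X lam).
Local Notation mgf := (mgf mu lam).

Let mpexp m n : measurable_fun setT (fun om => (pexp (fun=> - lam m)%R n (fun j => X [:: j] om))%:E).
Proof. by apply/measurable_EFinP; exact: measurable_pexp. Qed.

Lemma lam_le m n : (0 < m)%N -> (m <= n)%N -> (lam m <= lam n)%R.
Proof.
move=> m0 /subnKC <-; elim: (n - m)%N => [|k IH]; first by rewrite addn0.
by rewrite addnS (le_trans IH)// ltW// lam_inc// addn_gt0 m0.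
Qed.

Lemma lap_gt0 m n : (0 < m)%N -> (0 < lap m n)%R.
Proof.
move=> m0; rewrite lt_neqAle lap_ge0 andbT; apply/eqP => l0.
have := lapE P mX X0 lam0 n m0; rewrite -l0 => i0.
have : \int[P]_om `|(pexp (fun=> - lam m)%R n (fun j => X [:: j] om))%:E| = 0.
  by rewrite -[RHS]i0; apply: eq_integral => om _; rewrite gee0_abs// lee_fin pexp_ge0.
move/(ae_eq_integral_abs P measurableT (mpexp m n)) => [N [mN PN hN]].
have : [set: T] `<=` N.
  move=> om _; apply: hN => /= /(_ Logic.I) [] /eqP; rewrite pexpE.
  by rewrite gt_eqF// expR_gt0.
move=> TN; have : P setT <= P N by apply: le_measure; rewrite ?inE.
by rewrite PN probability_setT leNgt lte01.
Qed.

(** Integrating over the whole space removes the conditioning; [fine] in [pexp] changes the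
    integrand on a null set only. *)
Lemma lap_cond n : (0 < n)%N -> \int[P]_om g n (W [::] om) = (lap n n)%:E.
Proof.
move=> n0; have [_ g0 /(_ setT measurableT)] := hg n0.
rewrite preimage_setT => <-; rewrite -(lapE P mX X0 lam0 n n0).
apply: ae_eq_integral => //.
- have : measurable_fun setT (fun om => - ((lam n)%:E * \sum_(i < n) X [:: (i : nat)] om)).
    apply: measurableT_comp => //; apply: emeasurable_funM; first exact: measurable_cst.
    by apply: emeasurable_sum.
  by move=> h; apply: (measurableT_comp _ h); exact: measurable_expeR.
- apply: filterS Xfin => om h _.
  rewrite pexpE -mulr_sumr mulNr.
  have -> : \sum_(i < n) X [:: (i : nat)] om = (\sum_(j < n) fine (X [:: (j : nat)] om))%:E.
    rewrite -sumEFin; apply: eq_bigr => j _; rewrite fineK// ge0_fin_numE//.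
    exact: (h [::] j).
  by [].
Qed.

Lemma mgf_ge1 n : (0 < n)%N -> 1 <= \int[mu n]_y (expR (lam n * y))%:E.
Proof.
move=> n0; rewrite -[leLHS](mu_pos n).
have mpos : measurable [set y : R | (0 < y)%R].
  rewrite (_ : [set _ | _] = `]0%R, +oo[%classic); first exact: measurable_itv.
  by apply/seteqP; split => y /=; rewrite in_itv/= andbT.
rewrite -[X in mu n X]setIT -integral_indic//; apply: ge0_le_integral => //.
- exact/measurable_EFinP.
- apply/measurable_EFinP; apply: measurableT_comp => //; exact: measurable_funM.
move=> y _; rewrite lee_fin indicE; case: (boolP (y \in _)) => [|_]; last exact: expR_ge0.
by rewrite inE /= => y0; rewrite -expR0 ler_expR mulr_ge0// ltW// lam0.
Qed.

Let term_ge0 n : 0 <= (\int[mu n]_y (expR (lam n * y))%:E) * (lap n n)%:E.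
Proof.
apply: mule_ge0; last by rewrite lee_fin lap_ge0.
by apply: integral_ge0 => y _; rewrite lee_fin expR_ge0.
Qed.

Let hsum' : \sum_(n <oo) ((\int[mu n.+1]_y (expR (lam n.+1 * y))%:E) * (lap n.+1 n.+1)%:E) < +oo.
Proof.
apply: le_lt_trans hsum.
pose f n := (\int[mu n]_y (expR (lam n * y))%:E) * (lap n n)%:E.
rewrite [leRHS](_ : _ = \sum_(1 <= n <oo) f n); last first.
  by apply/congr_lim/funext => N; apply: eq_big_nat => n /andP[n0 _]; rewrite lap_cond.
rewrite -(nneseries_addn (f := f))//.
by under [leRHS]eq_eseriesr do rewrite addn1.
Qed.

(** Laplace transforms are positive, so an infinite moment would make the series of Assumption A (2)
    diverge. *)
Lemma mgf_fin n : (0 < n)%N -> \int[mu n]_y (expR (lam n * y))%:E < +oo.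
Proof.
case: n => // n _; rewrite ltey; apply/eqP => h.
have := @nneseries_pinfty _ (fun n =>
  (\int[mu n.+1]_y (expR (lam n.+1 * y))%:E) * (lap n.+1 n.+1)%:E) xpredT n.
rewrite h => /(_ _ isT) h'; move: hsum'; rewrite h' ?ltxx//.
by rewrite gt0_mulye// lte_fin lap_gt0.
Qed.

Let mgfE n : (0 < n)%N -> \int[mu n]_y (expR (lam n * y))%:E = (mgf n)%:E.
Proof.
move=> n0; rewrite fineK// ge0_fin_numE ?mgf_fin//.
by apply: integral_ge0 => y _; rewrite lee_fin expR_ge0.
Qed.

(** The term of rank [c.+1] in the series of Assumption A (2). *)
Let w c := (mgf c.+1 * lap c.+1 c.+1)%R.

Let w_ge0 c : (0 <= w c)%R.
Proof. by rewrite mulr_ge0// ?lap_ge0 ?mgf_ge0. Qed.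

Lemma summable_tail (e : R) : (0 < e)%R ->
  exists N0, forall N, (\sum_(N0 <= c < N) w c <= e)%R.
Proof.
move=> e0.
have wfin : \sum_(c <oo) (w c)%:E < +oo.
  by apply: le_lt_trans hsum'; apply: lee_nneseries => c *; rewrite ?lee_fin// EFinM -mgfE.
have w0 c : xpredT c -> 0 <= (w c)%:E by rewrite lee_fin.
have := nneseries_tail_cvg wfin w0.
move=> /fine_cvgP[_ ] /cvgrPdist_lt /(_ e e0) [N0 _ /(_ N0 (leqnn _))].
rewrite /= sub0r normrN => lt_e; exists N0 => N.
have s0 : 0 <= \sum_(N0 <= c <oo) (w c)%:E by apply: nneseries_ge0 => c _ _; exact: w0.
have sfin : \sum_(N0 <= c <oo) (w c)%:E \is a fin_num.
  rewrite ge0_fin_numE//; apply: le_lt_trans wfin.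
  rewrite (nneseries_split 0 N0) ?add0n//.
  rewrite -[leLHS]add0e; apply: leeD2r; apply: sume_ge0 => c _; exact: w0.
rewrite -lee_fin -sumEFin.
apply: (@le_trans _ _ (\sum_(N0 <= c <oo) (w c)%:E)).
  by apply: nneseries_lim_ge => c _ _; exact: w0.
by rewrite -(fineK sfin) lee_fin ltW// (le_lt_trans _ lt_e)// ler_norm.
Qed.

(** A larger [lam] lowers the Laplace transform, and [mgf] is at least 1 as the dominating variable
    is positive. Ordinary and record steps thus share one summable majorant that does not depend on
    [m]. *)
Lemma lap_le_weight m c : (c.+1 <= m)%N -> (lap m c.+1 <= w c)%R.
Proof.
move=> cm.
have m0 : (0 < m)%N by exact: leq_ltn_trans cm.
apply: (@le_trans _ _ (lap c.+1 c.+1)).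
  rewrite -lee_fin -!(lapE P mX X0 lam0)//; apply: ge0_le_integral => //.
    by move=> om _; rewrite lee_fin pexp_ge0.
  move=> om _; rewrite lee_fin !pexpE ler_expR; apply: ler_sum => j _.
  by rewrite ler_wpM2r ?fine_ge0// lerN2 lam_le.
rewrite ler_peMl ?lap_ge0// -lee_fin -mgfE//.
exact: mgf_ge1.
Qed.

Let E n := [set om | (\sum_(j < n) x j om = 0)%R].

Let mE n : measurable (E n).
Proof.
rewrite (_ : E n = (fun om => \sum_(j < n) x j om)%R @^-1` [set 0%R])//.
rewrite -[X in measurable X]setTI; apply: measurable_sum => // j.
by apply: (measurableT_comp (f := @fine R)).
Qed.

Let p n := fine (P (E n)).

(** Dominated convergence: for [s >= 0], [expR (- lam m * s)] tends to the indicator of [s = 0]. *)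
Lemma lap_cvg n : lap m n @[m --> \oo] --> p n.
Proof.
have : \int[P]_om (pexp (fun=> - lam m)%R n (fun j => X [:: j] om))%:E @[m --> \oo] -->
    \int[P]_om (\1_(E n) om)%:E.
  (* The index is shifted because [lam] is known to be positive from index 1 on. *)
  rewrite -(cvg_shiftS (fun m => \int[P]_om (pexp (fun=> - lam m)%R n (fun j => X [:: j] om))%:E))/=.
  apply: (@dominated_cvg _ _ _ P setT measurableT _ _ (fun=> 1)) => //.
  - move=> om _; apply: cvg_EFin; first by apply: nearW.
    rewrite /comp/=; under eq_fun do rewrite pexpE -mulr_sumr mulNr.
    rewrite indicE; case: (boolP (om \in E n)) => [|Eom].
      rewrite inE => Eom; rewrite -/(x _ om).
      under eq_fun do rewrite [X in (_ * X)%R]Eom mulr0 oppr0 expR0.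
      exact: cvg_cst.
    pose s := (\sum_(j < n) fine (X [:: (j : nat)] om))%R.
    have s0 : (0 < s)%R.
      rewrite lt_neqAle sumr_ge0 ?andbT; last by move=> *; rewrite fine_ge0.
      by apply: contraNneq Eom => Es; rewrite inE.
    have : (fun m => lam m.+1 * s)%R @ \oo --> +oo%R.
      have : (fun m => lam m.+1) @ \oo --> +oo%R by have := lam_y; rewrite -(cvg_shiftS lam).
      move=> /cvgryPge h; apply/cvgryPge => B.
      by apply: filterS (h (B / s)%R) => m; rewrite ler_pdivrMr.
    by move=> h; exact: (cvg_comp (fun m => lam m.+1 * s)%R (fun y => expR (- y)) h (@cvgr_expR R)).
  - apply/integrableP; split; first exact: measurable_cst.
    under eq_integral do rewrite /= normr1.
    by rewrite integral_cst// mul1e (le_lt_trans (probability_le1 P _)) ?ltry.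
  - move=> m om _; rewrite /= lee_fin ger0_norm ?pexp_ge0//.
    exact: pexp_neg_le1.
have pE : (p n)%:E = P (E n) by rewrite fineK ?fin_num_measure.
rewrite integral_indic// setIT => h.
by apply: (@fine_cvg _ _ _ _ (fun m =>
  \int[P]_om (pexp (fun=> - lam m)%R n (fun j => X [:: j] om))%:E) (p n)); rewrite pE.
Qed.

Lemma sum_lap_cvg N : (\sum_(c < N) lap m c.+1)%R @[m --> \oo] --> (\sum_(c < N) p c.+1)%R.
Proof.
elim: N => [|N IH].
  rewrite big_ord0; under eq_fun do rewrite big_ord0; exact: cvg_cst.
rewrite big_ord_recr/=; under eq_fun do rewrite big_ord_recr/=.
by apply: cvgD => //; exact: lap_cvg.
Qed.

Let SUP om : \bar R := ereal_sup
  ([set ((k.+1)%:R)%:E | k in [set k | X [:: k] om = 0]] `|` [set 0]).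

Let SUP_ge0 om : 0 <= SUP om.
Proof. by apply: ereal_sup_ubound; right. Qed.

Let mSUP : measurable_fun setT SUP.
Proof.
(* The supremum over the zeros becomes that of a sequence, the value 0 standing for a nonzero
   waiting time. *)
pose h k om : \bar R := ((k.+1)%:R * \1_(X [:: k] @^-1` [set 0]) om)%:E.
rewrite (_ : SUP = fun om => esups (h ^~ om) 0%N).
  apply: measurable_fun_esups => k; apply/measurable_EFinP/measurable_funM => //.
  by apply: measurable_indic; rewrite -[X in measurable X]setTI; exact: mX.
apply/funext => om; apply/eqP; rewrite eq_le; apply/andP; split.
  apply: ge_ereal_sup => _ [[k Xk <-]|->].
    apply: ereal_sup_ubound; exists k => //=.
    by rewrite /h indicE mem_set// mulr1.
  apply: (@le_trans _ _ (h 0%N om)); first by rewrite lee_fin mulr_ge0.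
  by apply: ereal_sup_ubound; exists 0%N.
apply: ge_ereal_sup => _ [k _ <-]; rewrite /h indicE.
case: (boolP (om \in _)) => [|_]; last by rewrite mulr0; exact: SUP_ge0.
by rewrite inE mulr1 => Xk; apply: ereal_sup_ubound; left; exists k.
Qed.

(** The events [E n] decrease, so the sum is the largest [n <= N] for which [E n] holds, and the
    waiting time of rank [n] is then 0 if [n > 0]. *)
Let sum_indic_le om N : (forall u j, X (rcons u j) om < +oo) ->
  (\sum_(c < N) \1_(E c.+1) om)%:E <= SUP om.
Proof.
move=> fin; elim: N => [|N IH]; first by rewrite big_ord0; exact: SUP_ge0.
have [EN|EN] := pselect (E N.+1 om); last first.
  by rewrite big_ord_recr/= [X in (_ + X)%R]indicE memNset// addr0.
apply: (@le_trans _ _ (N.+1%:R)%:E).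
  rewrite lee_fin -[leRHS]mulr_natr mul1r -[X in X%:R]card_ord -sumr_const.
  by apply: ler_sum => c _; rewrite indicE; case: (_ \in _).
apply: ereal_sup_ubound; left; exists N => //=.
have := EN; rewrite /E/= => /eqP; rewrite psumr_eq0; last by move=> *; exact: fine_ge0.
move/allP => /(_ ord_max); rewrite mem_index_enum => /(_ isT)/= /eqP xN.
by rewrite -(@fineK _ (X [:: N] om)) ?ge0_fin_numE//; [rewrite -/(x N om) xN|exact: (fin [::] N)].
Qed.

Lemma sum_p_le N : (\sum_(c < N) p c.+1)%:E <= \int[P]_om SUP om.
Proof.
apply: (@le_trans _ _ (\int[P]_om (\sum_(c < N) \1_(E c.+1) om)%:E)).
  under eq_integral do rewrite -sumEFin.
  rewrite ge0_integral_sum//; last by move=> c; exact/measurable_EFinP.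
  rewrite -sumEFin; apply: lee_sum => c _.
  by rewrite integral_indic// setIT fineK ?fin_num_measure.
apply: ae_ge0_le_integral => //.
- by move=> om _; rewrite lee_fin sumr_ge0.
- by apply/measurable_EFinP; apply: measurable_sum => c; exact: measurable_indic.
- by apply: filterS Xfin => om h _; exact: sum_indic_le.
Qed.

(** The first [N0] ranks contribute nearly a partial sum of [p], which Assumption A (3) keeps below
    1; the others form a small tail of the series of Assumption A (2). *)
Lemma exists_contraction : exists K rho, [/\ (0 < K)%N, (0 <= rho)%R, (rho < 1)%R &
  forall m N, (K <= m)%N ->
    (\sum_(c < N) factor P X mu lam m c.+1 * lap (maxn m c.+1) (maxn m c.+1)
     <= rho * lap m m)%R].
Proof.
have sfin : \int[P]_om SUP om \is a fin_num.
  by rewrite ge0_fin_numE ?(lt_trans hsup) ?ltry// integral_ge0.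
pose s := fine (\int[P]_om SUP om).
have s1 : (s < 1)%R by rewrite -lte_fin fineK.
have s0 : (0 <= s)%R by rewrite fine_ge0// integral_ge0.
(* Chosen so that [s + e + e = 1 - e]. *)
pose e := ((1 - s) / 3)%R.
have e0 : (0 < e)%R by rewrite divr_gt0// subr_gt0.
have [N0 hN0] := summable_tail e0.
have ps : (\sum_(c < N0) p c.+1 <= s)%R by rewrite -lee_fin fineK// sum_p_le.
have := @sum_lap_cvg N0; move/cvgrPdist_lt => /(_ e e0) [m0 _ hm0].
(* Beyond [m0] the first sum is within [e] of its limit; beyond [N0] the first [N0] ranks are
   ordinary steps. *)
exists (maxn m0 N0).+1, (s + e + e)%R; split => //.
- by rewrite !addr_ge0// ltW.
- by rewrite /e; lra.
move=> m N; rewrite gtn_max => /andP[m0m N0m].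
pose t c := if (c.+1 < m)%N then lap m c.+1 else w c.
(* The potential of the new state turns a record factor into [w c] times the old potential. *)
have ft c : (factor P X mu lam m c.+1 * lap (maxn m c.+1) (maxn m c.+1) = t c * lap m m)%R.
  rewrite /factor /t; case: ltnP => // _.
  by rewrite /w; ring.
under eq_bigr do rewrite ft.
rewrite -mulr_suml ler_wpM2r ?lap_ge0//.
have t0 c : (0 <= t c)%R by rewrite /t; case: ifP => _; rewrite ?lap_ge0.
have tw c : (t c <= w c)%R.
  by rewrite /t; case: ifP => // cm; apply: lap_le_weight; exact: ltnW.
apply: (@le_trans _ _ (\sum_(c < N0 + N) t c)%R).
  rewrite -(big_mkord xpredT t) -(big_mkord xpredT t) [leRHS](@big_cat_nat _ _ _ N)//= ?leq_addl//.
  by rewrite lerDl sumr_ge0.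
rewrite -(big_mkord xpredT t) (@big_cat_nat _ _ _ N0)//= ?leq_addr//.
apply: lerD; last by apply: le_trans (hN0 (N0 + N)%N); exact: ler_sum.
rewrite big_mkord (eq_bigr (fun c : 'I_N0 => lap m c.+1)); last first.
  by move=> c _; rewrite /t (leq_ltn_trans (ltn_ord c) N0m).
have := hm0 m (ltnW m0m); rewrite /= ltr_norml => /andP[h1 h2].
lra.
Qed.

End Contraction.

(** * Total weight and exclusion of infinite paths *)

Lemma ge_limn_einf (R : realType) (u : nat -> \bar R) (c : \bar R) :
  (forall n, u n <= c) -> limn_einf u <= c.
Proof.
move=> uc; rewrite limn_einf_lim; apply: lime_le.
  apply: ereal_nondecreasing_is_cvgn => m n mn; apply: ereal_inf_le_tmp => _ [k /= nk <-].
  by exists k => //=; exact: leq_trans nk.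
by apply: nearW => n; apply: le_trans (uc n); apply: ereal_inf_lbound; exists n => /=.
Qed.

Lemma le_limn_einf (R : realType) (u : nat -> \bar R) (c : \bar R) (N0 : nat) :
  (forall n, (N0 <= n)%N -> c <= u n) -> c <= limn_einf u.
Proof.
move=> uc; rewrite limn_einf_lim; apply: lime_ge.
  apply: ereal_nondecreasing_is_cvgn => m n mn; apply: ereal_inf_le_tmp => _ [k /= nk <-].
  by exists k => //=; exact: leq_trans nk.
exists N0 => // n /= N0n; apply: le_ereal_inf_tmp => _ [k /= nk <-].
exact/uc/(leq_trans N0n).
Qed.

(** Otherwise the exceptional indices contain a strictly increasing sequence, against
    [esum_lty_infinitely_small]. *)
Lemma esum_lty_eventually_small (R : realType) (a : seq nat -> \bar R) (v : nat -> seq nat) (e : R) :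
  (forall u, 0 <= a u) -> \esum_(u in [set: seq nat]) a u < +oo ->
  injective v -> (0 < e)%R -> exists k0, forall k, (k0 <= k)%N -> a (v k) < e%:E.
Proof.
move=> a0 fin vI e0; apply: contrapT => /forallNP h.
have /choice[f hf] : forall k0, exists k, (k0 <= k)%N /\ ~ (a (v k) < e%:E).
  by move=> k0; have /existsNP[k /not_implyP[]] := h k0; exists k.
pose s := fix s i := if i is i'.+1 then f (s i').+1 else f 0%N.
have sS i : (s i < s i.+1)%N by have [] := hf (s i).+1.
have sh i j : (i < j)%N -> (s i < s j)%N.
  elim: j => // j IH; rewrite ltnS leq_eqVlt => /predU1P[->//|/IH ij].
  exact: ltn_trans ij (sS j).
have sI : injective s.
  by move=> i j ij; case: (ltngtP i j) => // /sh; rewrite ij ltnn.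
have big k : ~ (a (v (s k)) < e%:E).
  by case: k => [|k]; [have [] := hf 0%N|have [] := hf (s k).+1].
have [k] := esum_lty_infinitely_small a0 fin (inj_comp vI sI) e0.
exact: big.
Qed.

Section PathWeights.
Context (R : realType) (d : measure_display) (T : measurableType d)
  (dS : measure_display) (S : measurableType dS) (P : probability T R)
  (X : seq nat -> T -> \bar R) (W : seq nat -> T -> S)
  (mu : nat -> probability R R) (lam : nat -> R) (K : nat) (rho : R).
Hypothesis mX : forall u, measurable_fun setT (X u).
Hypothesis mW : forall u, measurable_fun setT (W u).
Hypothesis X0 : forall u om, 0 <= X u om.
Hypothesis iid : iid_pairs P X W.
Hypothesis ci : cond_indep_given P (W [::]) (fun i => X [:: i]).
Hypothesis dom : forall (n : nat) (t : R) (B : set S), measurable B ->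
  P (W [::] @^-1` B `&` [set om | t%:E < \sum_(n <= i <oo) X [:: i] om])
  <= mu n [set y : R | (t < y)%R] * P (W [::] @^-1` B).
Hypothesis lam0 : forall n, (0 < n)%N -> (0 < lam n)%R.
Hypothesis Mfin : forall n, (0 < n)%N -> \int[mu n]_y (expR (lam n * y))%:E < +oo.
Hypothesis K0 : (0 < K)%N.
Hypothesis rho0 : (0 <= rho)%R.
Hypothesis rho1 : (rho < 1)%R.
Hypothesis contraction : forall m N, (K <= m)%N ->
  (\sum_(c < N) factor P X mu lam m c.+1 * lap P X lam (maxn m c.+1) (maxn m c.+1)
   <= rho * lap P X lam m m)%R.
Hypothesis lap_pos : forall m, (0 < m)%N -> (0 < lap P X lam m m)%R.

Let h m := lap P X lam m m.

(* The two summands serve the two kinds of infinite paths: those which stop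
   setting records, and those which set infinitely many of them. *)
Definition path_weight (u : seq nat) (N : nat) (om : T) : \bar R :=
  (path_exp X lam K u (N + state K u) om * h (state K u) +
   path_exp X lam K u (N + state K u) om *
     pexp (alpha_last lam (state K u)) (N + state K u) (fun j => X (rcons u j) om))%:E.

Lemma weightE m u : weight (factor P X mu lam) h m u =
  (\prod_(l < size u) factor P X mu lam (state m (take l u)) (nth 0%N u l).+1 * h (state m u))%R.
Proof.
elim: u m => [|c u IH] m /=; first by rewrite big_ord0 mul1r.
by rewrite IH big_ord_recl/= mulrA.
Qed.

Lemma path_weight_ge0 u N om : 0 <= path_weight u N om.
Proof. by rewrite lee_fin addr_ge0 ?mulr_ge0 ?path_exp_ge0 ?pexp_ge0// lap_ge0. Qed.

Let mpath u N : measurable_fun setT (path_exp X lam K u N).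
Proof. exact: measurable_path_exp. Qed.

Let mlast u N : measurable_fun setT
  (fun om => pexp (alpha_last lam (state K u)) N (fun j => X (rcons u j) om)).
Proof. by apply: measurable_pexp => j; exact: mX. Qed.

Lemma measurable_path_weight u N : measurable_fun setT (path_weight u N).
Proof.
apply/measurable_EFinP; apply: measurable_funD; apply: measurable_funM => //.
Qed.

Lemma integral_path_weight_le u N :
  \int[P]_om path_weight u N om <=
  (weight (factor P X mu lam) h K u)%:E + (weight (factor P X mu lam) h K u)%:E.
Proof.
(* The shift by [state K u] in [path_weight] makes the moment bounds valid for every [N]. *)
have sN : (state K u <= N + state K u)%N by exact: leq_addl.
under eq_integral do rewrite /path_weight EFinD.
rewrite ge0_integralD//.
- rewrite weightE; apply: leeD; last exact: path_exp_last_le.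
  under eq_integral do rewrite EFinM.
  rewrite ge0_integralZr//.
  + by rewrite [leRHS]EFinM lee_wpmul2r ?lee_fin ?lap_ge0//; exact: path_exp_le.
  + exact/measurable_EFinP.
  + by move=> om _; rewrite lee_fin path_exp_ge0.
  + by rewrite lee_fin lap_ge0.
- by move=> om _; rewrite lee_fin mulr_ge0 ?path_exp_ge0// lap_ge0.
- by apply/measurable_EFinP; exact: measurable_funM.
- by move=> om _; rewrite lee_fin mulr_ge0 ?path_exp_ge0// pexp_ge0.
- by apply/measurable_EFinP; exact: measurable_funM.
Qed.

(** Fatou's lemma carries the bound, uniform in [N], over to the lower limit; the contraction makes
    the bounds summable. *)
Lemma ae_esum_path_weight :
  {ae P, forall om, \esum_(u in [set: seq nat]) limn_einf (fun N => path_weight u N om) < +oo}.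
Proof.
apply: (ae_esum_lty (V := fun u om => limn_einf (fun N => path_weight u N om))
  (b := fun u => (weight (factor P X mu lam) h K u)%:E + (weight (factor P X mu lam) h K u)%:E)).
- move=> u; rewrite /limn_einf; apply: measurableT_comp => //.
  apply: (measurable_fun_limn_esup (f := fun N om => - path_weight u N om)) => N.
  by apply: measurableT_comp => //; exact: measurable_path_weight.
- by move=> u om; apply: (le_limn_einf (N0 := 0%N)) => N _; exact: path_weight_ge0.
- move=> u; apply: le_trans (fatou _ measurableT _ _) _.
  + by move=> N; exact: measurable_path_weight.
  + by move=> N om _; exact: path_weight_ge0.
  + by apply: ge_limn_einf => N; exact: integral_path_weight_le.
have f0 m n : (0 <= factor P X mu lam m n)%R by exact: factor_ge0.
have h0 m : (0 <= h m)%R by exact: lap_ge0.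
rewrite esumD; try by move=> u _; rewrite lee_fin weight_ge0.
have fin := esum_weight_lty f0 h0 rho0 rho1 contraction.
by rewrite lte_add_pinfty.
Qed.

Context (om : T).
Hypothesis X_fin : forall u j, X (rcons u j) om < +oo.
Hypothesis weight_fin :
  \esum_(u in [set: seq nat]) limn_einf (fun N => path_weight u N om) < +oo.

(** A record after [v k] keeps the second summand of the weight of [v k] above [e], so records stop.
    From then on the state is a constant [m] and the first summand stays above [e * h m], against
    the finite total weight. *)
Lemma no_infinite_heavy_path (v : nat -> seq nat) (c : nat -> nat) (theta : R) :
  v 0%N = [::] -> (forall k, v k.+1 = rcons (v k) (c k)) ->
  (forall k, rbirth X om (v k) <= theta)%R ->
  (forall k, exists N, theta < rbirth X om (v k) + psum X om (v k) N)%R -> False.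
Proof.
move=> v0 vS v_le v_star.
have X0_om u : 0 <= X u om by [].
have lam_ge0 n : (0 < n)%N -> (0 <= lam n)%R by move=> n0; exact/ltW/lam0.
have vI : injective v := path_inj v0 vS.
pose V u := limn_einf (fun N => path_weight u N om).
have V0 u : 0 <= V u by apply: (le_limn_einf (N0 := 0%N)) => N _; exact: path_weight_ge0.
pose e := expR (- lam K * theta).
have e0 : (0 < e)%R by exact: expR_gt0.
have st0 u : (0 < state K u)%N by exact: leq_trans K0 (state_ge _ _).
have lower k : exists N0, forall N, (N0 <= N)%N ->
    (e * expR (lam (state K (v k)) * (theta - rbirth X om (v k))) <= path_exp X lam K (v k) N om)%R.
  have [N0 hN0] := path_exp_lower X0_om X_fin lam_ge0 K0 v0 vS v_le v_star k.
  by exists N0 => N /hN0; rewrite expRD.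
have [k0 hk0] := esum_lty_eventually_small V0 weight_fin vI e0.
have no_record k : (k0 <= k)%N -> ((c k).+1 < state K (v k))%N.
  move=> /hk0; rewrite ltNge => /negP Vk; rewrite ltnNge; apply/negP => rec; apply: Vk.
  have [N0 hN0] := lower k.
  apply: (le_limn_einf (N0 := N0)) => N N0N; rewrite /path_weight lee_fin.
  set st := state K (v k) in rec hN0 *.
  have := hN0 (N + st)%N (leq_trans N0N (leq_addr _ _)).
  move=> low; rewrite ler_wpDl ?mulr_ge0 ?path_exp_ge0 ?lap_ge0//.
  apply: le_trans (ler_wpM2r (pexp_ge0 _ _ _) low).
  rewrite pexp_alpha_last ?leq_addl// pexp_psum -mulrA -expRD ler_peMr ?(ltW e0)//.
  rewrite -expR0 ler_expR mulNr -mulrBr mulr_ge0 ?lam_ge0 ?st0//.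
  (* The discounted waiting times fit into the time left, since a child of rank at least [st] is
     born by [theta]. *)
  have pm : (psum X om (v k) st <= psum X om (v k) (c k).+1)%R by exact: psum_le.
  have := v_le k.+1; rewrite vS rbirth_rcons//; lra.
pose m := state K (v k0).
have const k : state K (v (k0 + k)%N) = m.
  elim: k => [|k IH]; first by rewrite addn0.
  rewrite addnS vS state_rcons IH; apply/maxn_idPl.
  by rewrite ltnW// -IH no_record// leq_addr.
have eh0 : (0 < e * h m)%R by rewrite mulr_gt0// lap_pos// st0.
have [k1 hk1] := esum_lty_eventually_small V0 weight_fin vI eh0.
have := hk1 (k0 + k1)%N (leq_addl _ _); rewrite ltNge => /negP; apply.
have [N0 hN0] := lower (k0 + k1)%N.
apply: (le_limn_einf (N0 := N0)) => N N0N; rewrite /path_weight lee_fin.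
rewrite ler_wpDr ?mulr_ge0 ?path_exp_ge0 ?pexp_ge0// const ler_wpM2r ?lap_ge0//.
apply: le_trans (hN0 _ (leq_trans N0N (leq_addr _ _))).
rewrite ler_peMr ?(ltW e0)// -expR0 ler_expR mulr_ge0 ?subr_ge0 ?v_le//.
by rewrite lam_ge0.
Qed.

End PathWeights.

(** * The infinite star *)

Theorem mainTheorem1 (R : realType) (d : measure_display) (T : measurableType d)
  (dS : measure_display) (S : measurableType dS) (P : probability T R)
  (X : seq nat -> T -> \bar R) (W : seq nat -> T -> S) :
  (* X : U_oo -> [0, +oo] and W : U_oo -> S are random maps *)
  (forall u, measurable_fun setT (X u)) ->
  (forall u, measurable_fun setT (W u)) ->
  (forall u om, 0 <= X u om) ->
  (* standing assumptions *)
  iid_pairs P X W ->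
  cond_indep_given P (W [::]) (fun i => X [:: i]) ->
  (* Assumption A (1) and (2) *)
  (exists mu : nat -> probability R R,
     [/\ (forall n, mu n [set y : R | (0 < y)%R] = 1),
         (forall n, \int[mu n]_y (y%:E) < +oo),
         (forall (n : nat) (t : R) (B : set S), measurable B ->
            P (W [::] @^-1` B `&` [set om | t%:E < \sum_(n <= i <oo) X [:: i] om])
            <= mu n [set y : R | (t < y)%R] * P (W [::] @^-1` B)) &
     exists lam : nat -> R,
       [/\ (forall n, (0 < n)%N -> (0 < lam n)%R),
           (forall n, (0 < n)%N -> (lam n < lam n.+1)%R),
           lam @ \oo --> +oo%R &
       exists g : nat -> S -> \bar R,
         (forall n, (0 < n)%N ->
            cond_exp_version P (W [::])
              (fun om => expeR (- ((lam n)%:E * \sum_(i < n) X [:: (i : nat)] om))) (g n)) /\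
         \sum_(1 <= n <oo)
            ((\int[mu n]_y (expR (lam n * y))%:E) * \int[P]_om g n (W [::] om))
           < +oo]]) ->
  (* Assumption A (3) *)
  \int[P]_om ereal_sup ([set ((k.+1)%:R)%:E | k in [set k | X [:: k] om = 0]]
                         `|` [set 0]) < 1 ->
  (forall n, (0 < n)%N -> {ae P, forall om, 0 < \sum_(n <= i <oo) X [:: i] om}) ->
  (* conclusion: a.s. T_oo contains a node with infinitely many children *)
  {ae P, forall om, exists u, tree_inf X om u /\
           forall N, exists i, (N <= i)%N /\ tree_inf X om (rcons u i)}.
Proof.
move=> mX mW X0 iid ci [mu [mu_pos _ dom [lam [lam0 lam_inc lam_y [g [hg hsum]]]]]] hsup hpos.
have root_lty : {ae P, forall om, \sum_(0 <= i <oo) X [:: i] om < +oo}.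
  apply: (root_sum_lty mX X0 (mu0 := mu 0%N)) => t.
  have := dom 0%N t setT measurableT.
  by rewrite preimage_setT setTI probability_setT mule1.
have X_fin := children_lty mX X0 iid root_lty.
have Mfin := mgf_fin mX X0 X_fin lam0 hg hsum.
have [K [rho [K0 rho0 rho1 contraction]]] :=
  exists_contraction mX X0 X_fin mu_pos lam0 lam_inc lam_y hg hsum hsup.
have lap_pos m : (0 < m)%N -> (0 < lap P X lam m m)%R by exact: lap_gt0.
have sum_fin := ae_esum_path_weight mX mW X0 iid ci dom lam0 Mfin K0 rho0 rho1 contraction.
have tails := children_tail_pos mX X0 iid hpos.
(* From here on the argument is deterministic, on the intersection of four almost sure events. *)
apply: filterS (filterI root_lty (filterI X_fin (filterI sum_fin tails))) =>
  om [root_om [X_om [sum_om tail_om]]].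
have X0_om u : 0 <= X u om by [].
apply: (exists_infinite_star X0_om X_om).
- exists (fine (\sum_(0 <= i <oo) X [:: i] om)) => n.
  have sfin : \sum_(0 <= i <oo) X [:: i] om \is a fin_num.
    by rewrite ge0_fin_numE//; apply: nneseries_ge0.
  rewrite -lee_fin fineK// psumE// -(big_mkord xpredT (fun j => X (rcons [::] j) om)).
  exact: nneseries_lim_ge.
- move=> u n; have [j [nj xj]] := tail_om u n; exists j; split => //.
  by rewrite fine_gt0// xj X_om.
- exact: (no_infinite_heavy_path X0 lam0 K0 lap_pos X_om sum_om).
Qed.
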